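(* Let $n,d\ge1$ and let $\{L(t)\}_{t\ge0}$ be a measurable, locally essentially bounded family of $n\times n$ generalized Laplacian matrices. Consider the dynamics $$\dot{\mathbf{x}}(t)=-L(t)\mathbf{x}(t)+\mathbf{u}(t),\qquad \dot{w}(t)=-L(t)w(t),\qquad y_i(t)=\frac{x_i(t)}{w_i(t)},\quad i\in[n],$$ with $\mathbf{x}(t),\mathbf{u}(t)\in\mathbb{R}^{n\times d}$ and $w(t)\in\mathbb{R}^n$. Suppose that the flow $\{\Phi(t,s)\}$ defined by $\dot{\Phi}(t,s)=-L(t)\Phi(t,s)$, $\Phi(s,s)=I$, $t\ge s\ge0$, is a class $P^*$ weakly exponentially ergodic flow. Then this dynamics is a distributed flow tracker with respect to $Q=\mathbb{R}^{n\times d}\times\{\mathbf{1}\}$. Moreover, let $f_1,\dots,f_n:\mathbb{R}^d\to\mathbb{R}$ be convex and differentiable with bounded gradients such that $X^*=\operatorname{argmin}_{x\in\mathbb{R}^d}\sum_{i=1}^n f_i(x)$ is nonempty, and let $\alpha:[0,\infty)\to(0,1]$ be non-increasing with $\int_0^\infty\alpha(t)\,dt=\infty$ and $\int_0^\infty\alpha^2(t)\,dt<\infty$. Then, for the feedback $u_i(t)=-\alpha(t)\nabla f_i(y_i(t))$, $i\in[n]$, and any initial condition $\mathbf{x}(0)\in\mathbb{R}^{n\times d}$, $w(0)=\mathbf{1}$, there is some $x^*\in X^*$ such that $\lim_{t\to\infty}y_i(t)=x^*$ for all $i\in[n]$.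
   Context: Notation: $[n]=\{1,\dots,n\}$; $\mathbf{1}\in\mathbb{R}^n$ is the all-ones vector. Vectors in $\mathbb{R}^d=\mathbb{R}^{1\times d}$ (including gradients) are row vectors; $\mathbf{x}\in\mathbb{R}^{n\times d}$ has rows $x_1,\dots,x_n$ (similarly for $\mathbf{u}$), $w_i\in\mathbb{R}$ is the $i$th entry of $w$, and $\bar{x}=\frac1n\sum_{i=1}^n x_i$. $\|\cdot\|$ is the $\ell_2$-norm on vectors and the induced operator norm on matrices. Inequalities between vectors are entrywise. A generalized Laplacian matrix is a square matrix with non-positive off-diagonal entries whose columns add to zero. Solutions of the ODEs are in the Carathéodory sense; since $\{L(t)\}_{t\ge0}$ is a measurable, locally essentially bounded family of generalized Laplacian matrices, the solution $\Phi(t,s)$ of $\dot{\Phi}(t,s)=-L(t)\Phi(t,s)$, $\Phi(s,s)=I$, is well defined and column-stochastic for all $t\ge s\ge0$. $\mathbb{S}$ is the set of $n\times n$ column-stochastic matrices and $\mathbb{S}_1\subset\mathbb{S}$ the subset of rank-one ones (matrices with identical stochastic columns); $d(x,A)=\inf_{y\in A}\|x-y\|$. The flow $\{\Phi(t,s)\}$ is weakly exponentially ergodic if there are $\lambda\in(0,1)$ and $a>0$ with $d(\Phi(t,s),\mathbb{S}_1)\le a\lambda^{t-s}$ for all $t\ge s\ge0$. It is in class $P^*$ if there is $p^*>0$ with $\Phi(t,s)\mathbf{1}\ge p^*\mathbf{1}$ for all $t\ge s\ge0$. Distributed flow tracker (general definition): consider a dynamics $\dot{x}_i=p_i(t,\mathbf{x},\mathbf{w},u_i)$,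 $\dot{w}_i=q_i(t,\mathbf{x},\mathbf{w})$, $y_i=h_i(t,x_i,w_i,u_i)$, $i\in[n]$, with $x_i,y_i,u_i\in\mathbb{R}^d$, $w_i\in\mathbb{R}^{n_i}$, $n_i\ge0$, $N=\sum_i n_i$, $\mathbf{w}\in\mathbb{R}^N$. For a sequence of directed graphs $\mathcal{G}(t)=([n],\mathcal{E}(t))$, it is a distributed flow tracker with respect to $Q\subseteq\mathbb{R}^{n\times d}\times\mathbb{R}^N$ if: (I) $\frac{\partial p_i}{\partial x_j}=\frac{\partial p_i}{\partial w_j}=\frac{\partial q_i}{\partial x_j}=\frac{\partial q_i}{\partial w_j}=0$ for all $(i,j)\notin\mathcal{E}(t)$ and all $t\ge0$; (II) for some constant $c_1>0$, $\dot{\bar{x}}(t)=c_1\sum_{i=1}^n u_i(t)$; (III) for all $i\in[n]$, $\|y_i(t)-\bar{x}(t)\|\le c_2\left(\lambda^t\|\mathbf{x}(0)\|+\int_0^t\lambda^{t-s}\|\mathbf{u}(s)\|\,ds\right)$ holds for all initial conditions $(\mathbf{x}(0),\mathbf{w}(0))\in Q$ and all smooth control inputs $\mathbf{u}:\mathbb{R}^+\to\mathbb{R}^{n\times d}$, for some $\lambda\in[0,1)$ and $c_2>0$ (possibly dependent on $\mathbf{u}$). In this theorem $n_i=1$, $N=n$, and the graph sequence is the one associated with $L(t)$: $(i,j)\in\mathcal{E}(t)$ iff $i=j$ or $L_{ij}(t)\neq0$. *)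

(* Defs.v *)
From HB Require Import structures.
From mathcomp Require Import all_boot all_order all_algebra.
From mathcomp Require Import all_classical all_reals all_analysis.
From mathcomp Require Import measurable_realfun.
Set Implicit Arguments.
Unset Strict Implicit.
Unset Printing Implicit Defensive.
Import Order.TTheory GRing.Theory Num.Theory.
Import numFieldNormedType.Exports.
Local Open Scope classical_set_scope.
Local Open Scope ring_scope.

(* The library norm on matrices is the sup norm of the entries; it is only used
   for the topology, derivatives and absolute continuity (where all norms are
   equivalent). Quantitative bounds use the two norms below. *)

Definition l2norm (R : realType) (k : nat) (v : 'rV[R]_k) : R :=
  Num.sqrt (\sum_j v 0 j ^+ 2).

Definition opnorm (R : realType) (m k : nat) (A : 'M[R]_(m, k)) : R :=
  sup [set l2norm (A *m z)^T | z in [set z : 'cV[R]_k | l2norm z^T <= 1]].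

Definition dist (R : realType) (m k : nat) (A : 'M[R]_(m, k))
    (S : set 'M[R]_(m, k)) : R :=
  inf [set opnorm (A - B) | B in S].

(* [s] lists finitely many non-overlapping intervals [I.1, I.2]. *)
Definition abs_continuous (R : realType) (V : normedModType R) (a b : R)
    (f : R -> V) : Prop :=
  forall e : R, 0 < e -> exists2 delta : R, 0 < delta &
    forall s : seq (R * R),
      all (fun I => [&& a <= I.1, I.1 < I.2 & I.2 <= b]) s ->
      pairwise (fun I J => (I.2 <= J.1) || (J.2 <= I.1)) s ->
      \sum_(I <- s) (I.2 - I.1) < delta ->
      \sum_(I <- s) `|f I.2 - f I.1| < e.

(* z is a solution on [s, +oo[ of z'(t) = v(t); for an ODE, v(t) is the
   right-hand side evaluated along z. *)
Definition caratheodory_sol (R : realType) (V : normedModType R) (s : R)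
    (z v : R -> V) : Prop :=
  (forall T : R, s <= T -> abs_continuous s T z) /\
  {ae @lebesgue_measure R, forall t : R, s < t -> is_derive t 1 z (v t)}.

Definition generalized_laplacian (R : realType) (n : nat) (A : 'M[R]_n) : Prop :=
  (forall i j, i != j -> A i j <= 0) /\ (forall j, \sum_i A i j = 0).

(* Measurability with respect to the Lebesgue (completed Borel) sets. *)
Definition lebesgue_measurable_fun (R : realType) (D : set R) (f : R -> R)
    : Prop :=
  forall B : set R, measurable B ->
    completed_algebra_gen (@lebesgue_measure R) (D `&` f @^-1` B).

Definition measurable_family (R : realType) (n : nat) (L : R -> 'M[R]_n)
    : Prop :=
  forall i j, lebesgue_measurable_fun `[0, +oo[ (fun t => L t i j).

Definition locally_ess_bounded (R : realType) (n : nat) (L : R -> 'M[R]_n)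
    : Prop :=
  forall T : R, 0 <= T -> exists M : R,
    {ae @lebesgue_measure R, forall t : R, 0 <= t <= T -> opnorm (L t) <= M}.

Definition is_flow (R : realType) (n : nat) (L : R -> 'M[R]_n)
    (Phi : R -> R -> 'M[R]_n) : Prop :=
  forall s : R, 0 <= s -> Phi s s = 1%:M /\
    caratheodory_sol s (fun t => Phi t s) (fun t => - L t *m Phi t s).

Definition column_stochastic (R : realType) (n : nat) : set 'M[R]_n :=
  [set A | (forall i j, 0 <= A i j) /\ (forall j, \sum_i A i j = 1)].

Definition rank1_stochastic (R : realType) (n : nat) : set 'M[R]_n :=
  [set A | column_stochastic A /\ \rank A = 1%N].

Definition weakly_exp_ergodic (R : realType) (n : nat)
    (Phi : R -> R -> 'M[R]_n) : Prop :=
  exists lambda a : R, [/\ 0 < lambda < 1, 0 < a &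
    forall s t : R, 0 <= s -> s <= t ->
      dist (Phi t s) (@rank1_stochastic R n) <= a * lambda `^ (t - s)].

Definition class_Pstar (R : realType) (n : nat) (Phi : R -> R -> 'M[R]_n)
    : Prop :=
  exists2 p : R, 0 < p & forall s t : R, 0 <= s -> s <= t ->
    forall i, p <= (Phi t s *m (const_mx 1 : 'cV[R]_n)) i 0.

Definition wstate (R : realType) (n : nat) (m : 'I_n -> nat) : Type :=
  forall i : 'I_n, 'rV[R]_(m i).

(* x_i' = p_i(t, x, w, u_i), w_i' = q_i(t, x, w), y_i = h_i(t, x_i, w_i, u_i). *)
Record dynamics (R : realType) (n d : nat) (m : 'I_n -> nat) := Dynamics {
  dyn_p : 'I_n -> R -> 'M[R]_(n, d) -> wstate R m -> 'rV[R]_d -> 'rV[R]_d;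
  dyn_q : forall i : 'I_n, R -> 'M[R]_(n, d) -> wstate R m -> 'rV[R]_(m i);
  dyn_h : forall i : 'I_n,
    R -> 'rV[R]_d -> 'rV[R]_(m i) -> 'rV[R]_d -> 'rV[R]_d }.
Arguments dyn_h {R n d m} _ i _ _ _ _.

Definition set_row (R : realType) (n d : nat) (x : 'M[R]_(n, d)) (j : 'I_n)
    (v : 'rV[R]_d) : 'M[R]_(n, d) :=
  \matrix_(k < n) (if k == j then v else row k x).

Definition avg (R : realType) (n d : nat) (x : 'M[R]_(n, d)) : 'rV[R]_d :=
  n%:R^-1 *: \sum_(i < n) row i x.

Definition trajectory (R : realType) (n d : nat) (m : 'I_n -> nat)
    (S : dynamics R d m) (u : R -> 'M[R]_(n, d)) (x : R -> 'M[R]_(n, d))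
    (w : R -> wstate R m) : Prop :=
  forall i : 'I_n,
    caratheodory_sol 0 (fun t => row i (x t))
      (fun t => dyn_p S i t (x t) (w t) (row i (u t))) /\
    caratheodory_sol 0 (fun t => w t i) (fun t => dyn_q S i t (x t) (w t)).

Definition output (R : realType) (n d : nat) (m : 'I_n -> nat)
    (S : dynamics R d m) (u x : R -> 'M[R]_(n, d)) (w : R -> wstate R m)
    (i : 'I_n) (t : R) : 'rV[R]_d :=
  dyn_h S i t (row i (x t)) (w t i) (row i (u t)).

(* C^infinity on [0, +oo[: restriction of a smooth function on R. *)
Definition smooth_input (R : realType) (n d : nat) (u : R -> 'M[R]_(n, d))
    : Prop :=
  exists v : R -> 'M[R]_(n, d),
    (forall (k : nat) (t : R), derivable (derive1n k v) t 1) /\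
    (forall t : R, 0 <= t -> u t = v t).

(* Vanishing of the Jacobians of p_i and q_i in x_j and w_j at every point,
   for (i, j) not an edge. *)
Definition local_on_graph (R : realType) (n d : nat) (m : 'I_n -> nat)
    (S : dynamics R d m) (E : R -> rel 'I_n) : Prop :=
  forall (t : R) (i j : 'I_n), 0 <= t -> ~~ E t i j ->
  forall (x : 'M[R]_(n, d)) (w : wstate R m) (ui : 'rV[R]_d),
    [/\ is_diff (row j x)
          (fun v : 'rV[R]_d => dyn_p S i t (set_row x j v) w ui) (cst 0),
        is_diff (w j)
          (fun v : 'rV[R]_(m j) => dyn_p S i t x (dfwith w j v) ui) (cst 0),
        is_diff (row j x)
          (fun v : 'rV[R]_d => dyn_q S i t (set_row x j v) w) (cst 0) &
        is_diff (w j)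
          (fun v : 'rV[R]_(m j) => dyn_q S i t x (dfwith w j v)) (cst 0)].

(* The derivative of the average is c1 * sum_i u_i in the Caratheodory sense,
   with one constant c1 for all inputs and initial conditions. *)
Definition average_integrates_input (R : realType) (n d : nat)
    (m : 'I_n -> nat) (S : dynamics R d m) : Prop :=
  exists2 c1 : R, 0 < c1 &
    forall (u x : R -> 'M[R]_(n, d)) (w : R -> wstate R m),
      trajectory S u x w ->
      caratheodory_sol 0 (fun t => avg (x t))
        (fun t => c1 *: \sum_(i < n) row i (u t)).

(* lambda and c2 may depend on the input u, but not on the initial condition,
   the agent or the time. *)
Definition outputs_track_average (R : realType) (n d : nat)
    (m : 'I_n -> nat) (S : dynamics R d m)
    (Q : set ('M[R]_(n, d) * wstate R m)) : Prop :=
  forall u : R -> 'M[R]_(n, d), smooth_input u ->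
  exists lambda c2 : R, [/\ 0 <= lambda < 1, 0 < c2 &
    forall (x : R -> 'M[R]_(n, d)) (w : R -> wstate R m),
      trajectory S u x w -> Q (x 0, w 0) ->
      forall (i : 'I_n) (t : R), 0 <= t ->
        l2norm (output S u x w i t - avg (x t)) <=
        c2 * (lambda `^ t * opnorm (x 0) +
              \int[@lebesgue_measure R]_(s in `[0, t])
                 (lambda `^ (t - s) * opnorm (u s)))].

Definition distributed_flow_tracker (R : realType) (n d : nat)
    (m : 'I_n -> nat) (S : dynamics R d m) (E : R -> rel 'I_n)
    (Q : set ('M[R]_(n, d) * wstate R m)) : Prop :=
  [/\ local_on_graph S E, average_integrates_input S
    & outputs_track_average S Q].

Definition laplacian_graph (R : realType) (n : nat) (L : R -> 'M[R]_n)
    : R -> rel 'I_n :=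
  fun t i j => (i == j) || (L t i j != 0).

(* The division x_i / w_i is total, with x / 0 = 0. *)
Definition pushsum (R : realType) (n d : nat) (L : R -> 'M[R]_n)
    : dynamics R d (fun _ : 'I_n => 1%N) :=
  @Dynamics R n d (fun=> 1%N)
    (fun i t x w ui => - row i (L t *m x) + ui)
    (fun i t x w => - \sum_j L t i j *: w j)
    (fun i t xi wi ui => (wi 0 0)^-1 *: xi).

Definition unit_weights (R : realType) (n d : nat)
    : set ('M[R]_(n, d) * wstate R (fun _ : 'I_n => 1%N)) :=
  [set z | forall i, z.2 i = const_mx 1].

Definition gradient (R : realType) (d : nat) (f : 'rV[R]_d -> R)
    (z : 'rV[R]_d) : 'rV[R]_d :=
  \row_j 'D_(delta_mx 0 j) f z.

Definition argmin_sum (R : realType) (n d : nat)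
    (f : 'I_n -> 'rV[R]_d -> R) : set 'rV[R]_d :=
  [set z | forall z', \sum_i f i z <= \sum_i f i z'].

(* Main.v *)
Require Import Defs.
From HB Require Import structures.
From mathcomp Require Import all_boot all_order all_algebra.
From mathcomp Require Import all_classical all_reals all_analysis.
From mathcomp Require Import measurable_realfun ring lra.
Set Implicit Arguments.
Unset Strict Implicit.
Unset Printing Implicit Defensive.
Import Order.TTheory GRing.Theory Num.Theory.
Import numFieldNormedType.Exports.
Local Open Scope classical_set_scope.
Local Open Scope ring_scope.

(** The argument is by comparison: no variation-of-constants formula is used,
so the state never has to be written as an integral against the flow.

Everything rests on one fact about the generalized Laplacian. The Euler step
[1 - h L(t)] is column stochastic for small [h], hence does not increase the
sum [l1norm] of the absolute values of the entries. Therefore a solution of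
[z' = - L z + v] satisfies [|z(T)| - |z(s)| <= U(T) - U(s)] as soon as
[|v| <= U'] ([laplacian_flow_l1_le]). Passing from this one-sided estimate of
difference quotients, valid for almost every time, to an inequality between
values is the role of [abs_continuous_le].

Let [xbar] be the average of the agents and [D = x - w xbar] the disagreement.
Its columns sum to zero, and [y_i - xbar = D_i / w_i], where class P* keeps
[w_i] away from [0]; so the tracking error is controlled by [|D|]. Over a time
[T] the ergodic flow moves close to a rank-one stochastic matrix, which
annihilates zero-sum columns, and so halves [|D|], up to the input received
meanwhile ([disagreement_flow_le], [ergodic_halves_zero_sum]). To stay within
linear equations, [D] is compared on [[s, t]] with [x - w xbar(s)], in which
the average is frozen. Iterating the halving gives the exponentially discounted
bound that defines a tracker ([contraction_telescope], [pushsum_tracks]).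

For the gradient feedback put [t_k = k T], [a_k = alpha(t_k)] and
[e_k = |D(t_k)|]. Since [alpha] is monotone, the input on [[t_k, t_(k+1)]] is
at most a constant times [a_k], whence [e_(k+1) <= e_k / 2 + C a_k], and the
summability of [a_k^2] gives that of [e_k^2]. The average follows a perturbed
gradient flow: by convexity, for every minimiser [z] of [F = sum_i f_i],
[|xbar(t_(k+1)) - z|^2 <= |xbar(t_k) - z|^2
   - c a_(k+1) (F(xbar(t_k)) - F(z)) + b_k]
with [b_k] of order [a_k^2 + a_k e_k], which is summable ([sqdist_descent]).
As [a_k] is not summable, [F(xbar(t_k))] comes arbitrarily close to the minimum
along a subsequence; a cluster point of that subsequence is a minimiser, and
the same inequality at this minimiser forces convergence of the whole sequence
([quasi_fejer_converges]). Between sampling times the average moves little,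
and the outputs follow it because [D] tends to zero. *)

(** * Comparison for absolutely continuous functions *)

(** The intervals need only be non-overlapping; removing the open interval of
the head from [A] keeps the others inside, since they may meet it only at
endpoints. *)
Lemma sum_lengths_le_measure (R : realType) (A : set R) (s : seq (R * R)) :
  measurable A ->
  (forall I, I \in s -> I.1 < I.2 /\ `]I.1, I.2[ `<=` A) ->
  pairwise (fun I J => (I.2 <= J.1) || (J.2 <= I.1)) s ->
  ((\sum_(I <- s) (I.2 - I.1))%:E <= @lebesgue_measure R A)%E.
Proof.
elim: s A => [|I s IHs] A mA sA /=; first by rewrite big_nil.
move=> /andP[/allP Is ps].
have [I12 IA] := sA I (mem_head _ _).
rewrite big_cons EFinD.
have -> : A = `]I.1, I.2[ `|` (A `\` `]I.1, I.2[) by rewrite setDUK.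
rewrite measureU//; last 2 first.
- exact: measurableD.
- by rewrite setDIK.
apply: leeD.
  rewrite [leRHS](_ : _ = (I.2 - I.1)%:E)//.
  by apply: etrans (lebesgue_measure_itv _) _; rewrite /= lte_fin I12.
apply: IHs => //; first exact: measurableD.
move=> J Js; have [J12 JA] := sA J (mem_behead (s := I :: s) Js).
split=> // r Jr; split; first exact: JA.
move: Jr; rewrite /= !in_itv/= => /andP[J1r rJ2] /andP[I1r rI2].
by case/orP: (Is J Js) => IJ; [have := lt_trans rI2 (le_lt_trans IJ J1r)
  |have := lt_trans rJ2 (le_lt_trans IJ I1r)]; rewrite ltxx.
Qed.

Lemma abs_continuous_near (R : realType) (f : R -> R) (a b e : R) :
  abs_continuous a b f -> 0 < e -> exists2 delta : R, 0 < delta &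
    forall s t, a <= s -> s <= t -> t <= b -> t - s < delta ->
      `|f t - f s| < e.
Proof.
move=> fab e0; have [delta delta0 H] := fab e e0; exists delta => // s t as_ st tb tsd.
have [<-|neqst] := eqVneq s t; first by rewrite subrr normr0.
have /= := H [:: (s, t)]; rewrite !big_seq1/=; apply => //.
by rewrite as_ tb lt_neqAle neqst st.
Qed.

(** A continuous function whose upper right Dini derivative is nonpositive
everywhere is nonincreasing. Here the Dini bound may fail on a null set; that
set is covered by an open set [W] so small that, by absolute continuity, the
total variation of [f] over intervals in [W] is less than [e]. The supremum
argument then advances by the Dini bound outside [W], and by one more interval
of [W] inside it. As [U] is nondecreasing, it can only help in the second kind
of step and in the passage to the supremum. *)
Lemma abs_continuous_le (R : realType) (f U : R -> R) (a b : R) : a <= b ->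
  abs_continuous a b f ->
  (forall s t, a <= s -> s <= t -> t <= b -> U s <= U t) ->
  {ae @lebesgue_measure R, forall t, a < t -> t < b -> forall e, 0 < e ->
    \forall h \near 0^'+, f (t + h) - f t <= U (t + h) - U t + e * h} ->
  f b - f a <= U b - U a.
Proof.
move=> ab fac Und fU.
apply/ler_addgt0Pl => e0 e0_gt0.
have [e e_gt0 ebound] : exists2 e, 0 < e & e * (b - a) + e + e <= e0.
  exists (e0 / (b - a + 2)); first by rewrite divr_gt0// ltr_wpDl// subr_ge0.
  have : e0 / (b - a + 2) * (b - a + 2) = e0.
    by rewrite mulfVK// gt_eqF// ltr_wpDl// subr_ge0.
  lra.
have [delta delta_gt0 fdelta] := fac e e_gt0.
pose mu : measure _ _ := @lebesgue_measure R.
have [W [Wopen nWD muW]] : exists W : set R, [/\ open W,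
    forall t, a <= t -> t < b -> ~ W t -> forall e, 0 < e ->
      \forall h \near 0^'+, f (t + h) - f t <= U (t + h) - U t + e * h &
    (mu W < delta%:E)%E].
  have [N [mN muN0 NP]] := fU.
  have mNa : measurable (N `|` [set a]) by exact: measurableU.
  have muNa : mu (N `|` [set a]) = 0.
    apply/eqP; rewrite -measure_le0 (le_trans (measureU2 _ _ _))//.
    by rewrite [X in (X + _)%E]muN0 add0e; rewrite [leLHS](lebesgue_measure_set1 a).
  have [|W [Wopen NaW muWd]] := lebesgue_regularity_outer mNa _ delta_gt0.
    by rewrite [X in (X < _)%E]muNa.
  exists W; split => //.
    move=> t; rewrite le_eqVlt => /orP[/eqP <- _ aW|at_ tb tnW].
      by exfalso; apply: aW; apply: NaW; right.
    have {}tN : ~ N t by move=> Nt; apply: tnW; apply: NaW; left.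
    by have := contra_not (NP t) tN => /contrapT; exact.
  rewrite -(setDUK NaW) (le_lt_trans (measureU2 _ _ _))//.
    by apply: measurableD => //; exact: open_measurable.
  by rewrite [X in (X + _)%E]muNa add0e.
(* [S] records the times up to which the inequality holds with an extra
   allowance for the variation of [f] over a family of intervals of [W]. *)
pose fam t (s : seq (R * R)) := [/\
  forall I, I \in s -> [/\ a <= I.1, I.1 < I.2, I.2 <= t & `]I.1, I.2[ `<=` W] &
  pairwise (fun I J => (I.2 <= J.1) || (J.2 <= I.1)) s].
pose var (s : seq (R * R)) := \sum_(I <- s) `|f I.2 - f I.1|.
have fam_widen t t' s : t <= t' -> fam t s -> fam t' s.
  move=> tt' [H ?]; split => // I /H[? ? ? ?]; split => //.
  exact: le_trans tt'.
have var_lt s : fam b s -> var s < e.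
  move=> [sH sP]; apply: fdelta => //.
    by apply/allP => I /sH [-> -> ->].
  rewrite -lte_fin; apply: le_lt_trans muW; apply: sum_lengths_le_measure => //.
    exact: open_measurable.
  by move=> I /sH[].
pose S := [set t | a <= t <= b /\ forall eta, 0 < eta -> exists2 s, fam t s &
  f t - f a <= U t - U a + e * (t - a) + eta + var s].
have Sa : S a.
  split; first by rewrite lexx.
  by move=> eta eta0; exists [::] => //; rewrite /var big_nil !subrr mulr0; lra.
have supS : has_sup S.
  by split; [exists a|exists b => t [/andP[]]].
have at0 : a <= sup S by apply: sup_upper_bound.
have t0b : sup S <= b.
  by apply: ge_sup; [exists a|move=> t [/andP[]]].
have St0 : S (sup S).
  split; first by rewrite at0.
  move=> eta eta0; have eta20 : 0 < eta / 2 by rewrite divr_gt0.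
  have [d1 d10 fd1] := abs_continuous_near fac eta20.
  have [t St t0t] := sup_adherent d10 supS.
  have tt0 : t <= sup S by apply: sup_upper_bound.
  have [/andP[at_ tb] /(_ _ eta20)[s fs Hs]] := St.
  exists s; first exact: fam_widen fs.
  have := fd1 _ _ at_ tt0 t0b _; rewrite ltrBlDr -ltrBlDl => /(_ t0t).
  move=> /(le_lt_trans (ler_norm _)) Hf.
  have HU := Und _ _ at_ tt0 t0b.
  have He : e * (t - a) <= e * (sup S - a) by rewrite ler_pM2l// lerD2r.
  lra.
have : S b; last first.
  move=> [_ /(_ _ e_gt0)[s fs Hs]].
  have := var_lt _ fs; lra.
have [<-//|t0neqb] := eqVneq (sup S) b.
have t0_lt_b : sup S < b by rewrite lt_neqAle t0neqb.
exfalso.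
have step h : 0 < h -> sup S + h <= b -> ~ S (sup S + h).
  move=> h0 hb Sh; have := sup_upper_bound supS Sh.
  by rewrite leNgt ltrDl h0.
set t0 := sup S in St0 at0 t0b t0neqb t0_lt_b step *.
have nearb : \forall h \near 0^'+, t0 + h <= b.
  near=> h; rewrite -lerBrDl; near: h.
  by apply: nbhs_right_le; rewrite subr_gt0.
(* Beyond [t0 = sup S]: either one more interval of [W], or the Dini bound. *)
have [Wt0|nWt0] := pselect (W t0).
  have nearW : \forall h \near 0^'+, `]t0, t0 + h[ `<=` W.
    have /nbhs_ballP[r /= r0 rW] : nbhs t0 W by apply: open_nbhs_nbhs; split.
    near=> h => t /=; rewrite in_itv/= => /andP[t0t th].
    apply: rW; rewrite /ball/= ltr_distlC; apply/andP; split.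
      by rewrite (lt_trans _ t0t)// ltrBlDr ltrDl.
    rewrite (lt_le_trans th)// lerD2l; near: h.
    exact: nbhs_right_le.
  have [h [h0 [hb hW]]] : exists h, 0 < h /\ t0 + h <= b /\ `]t0, t0 + h[ `<=` W.
    suff : \forall h \near (0:R)^'+, 0 < h /\ t0 + h <= b /\ `]t0, t0 + h[ `<=` W.
      by move=> /filter_ex.
    by near=> h; split; [|split]; near: h => //; exact: nbhs_right_gt.
  apply: (step h h0 hb); split; first by rewrite hb ler_wpDr// ltW.
  move=> eta eta0; have [_ /(_ _ eta0) [s fs Hs]] := St0.
  exists ((t0, t0 + h) :: s).
    split.
      move=> I; rewrite inE => /predU1P[->/=|Is].
        by split => //; rewrite ltrDl.
      have [/(_ I Is) [? ? It0 ?] _] := fs; split => //.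
      by rewrite (le_trans It0)// ler_wpDr// ltW.
    rewrite /= (proj2 fs) andbT; apply/allP => I Is.
    by have [/(_ I Is) [? ? -> ?] _] := fs; rewrite orbT.
  rewrite /var big_cons /= -/(var s).
  have := ler_norm (f (t0 + h) - f t0).
  have : U t0 <= U (t0 + h) by rewrite Und// ler_wpDr// ltW.
  have : 0 < e * h by rewrite mulr_gt0.
  lra.
have [h [h0 [hb hf]]] : exists h, 0 < h /\ t0 + h <= b /\
    f (t0 + h) - f t0 <= U (t0 + h) - U t0 + e * h.
  have H := nWD _ at0 t0_lt_b nWt0 _ e_gt0.
  suff : \forall h \near (0:R)^'+, 0 < h /\ t0 + h <= b /\
      f (t0 + h) - f t0 <= U (t0 + h) - U t0 + e * h.
    by move=> /filter_ex.
  by near=> h; split; [|split]; near: h => //; exact: nbhs_right_gt.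
apply: (step h h0 hb); split; first by rewrite hb ler_wpDr// ltW.
move=> eta eta0; have [_ /(_ _ eta0) [s fs Hs]] := St0.
exists s; first by apply: fam_widen fs; rewrite ler_wpDr// ltW.
lra.
Unshelve. all: by end_near. Qed.

(** * Linear calculus of Caratheodory solutions *)

(** All closure properties of absolute continuity below follow from this one,
because the operations involved are Lipschitz in their arguments. *)
Lemma abs_continuous_dominated (R : realType) (V W : normedModType R)
    (I : finType) (a b K : R) (z : I -> R -> V) (h : R -> W) : 0 <= K ->
  (forall r t, a <= r -> r <= t -> t <= b ->
    `|h t - h r| <= K * \sum_i `|z i t - z i r|) ->
  (forall i, abs_continuous a b (z i)) -> abs_continuous a b h.
Proof.
move=> K0 hz zac e e0.
pose N := K * #|I|%:R + 1.
have N0 : 0 < N by rewrite ltr_wpDl// mulr_ge0.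
have eN0 : 0 < e / N by rewrite divr_gt0.
have /choice[delta deltaP] : forall i, exists delta, 0 < delta /\
    forall s : seq (R * R),
      all (fun I => [&& a <= I.1, I.1 < I.2 & I.2 <= b]) s ->
      pairwise (fun I J => (I.2 <= J.1) || (J.2 <= I.1)) s ->
      \sum_(I <- s) (I.2 - I.1) < delta ->
      \sum_(I <- s) `|z i I.2 - z i I.1| < e / N.
  by move=> i; have [delta d0 H] := zac i _ eN0; exists delta.
exists (\big[Order.min/1]_i delta i).
  by apply: lt_bigmin => // i _; have [] := deltaP i.
move=> s sab sdis sdelta.
have zs i : \sum_(J <- s) `|z i J.2 - z i J.1| <= e / N.
  apply/ltW; have [_] := deltaP i; apply => //.
  by apply: lt_le_trans sdelta _; exact: bigmin_le_cond.
apply: (@le_lt_trans _ _ (K * \sum_i \sum_(J <- s) `|z i J.2 - z i J.1|)).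
  rewrite exchange_big/= mulr_sumr !big_seq; apply: ler_sum => J Js.
  by have /allP/(_ _ Js)/and3P[? /ltW ? ?] := sab; exact: hz.
apply: (@le_lt_trans _ _ (K * \sum_(i : I) e / N)).
  by rewrite ler_wpM2l// ler_sum.
rewrite sumr_const -[X in K * X]mulr_natr mulrCA -mulrA -[ltRHS]mulr1 ltr_pM2l//.
by rewrite mulrC ltr_pdivrMr// mul1r ltrDl.
Qed.

Lemma caratheodory_sol_dominated (R : realType) (V W : normedModType R)
    (I : finType) (s K : R) (z v : I -> R -> V) (h g : R -> W) : 0 <= K ->
  (forall r t, s <= r -> r <= t ->
    `|h t - h r| <= K * \sum_i `|z i t - z i r|) ->
  (forall t, s < t -> (forall i, is_derive t 1 (z i) (v i t)) ->
    is_derive t 1 h (g t)) ->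
  (forall i, caratheodory_sol s (z i) (v i)) -> caratheodory_sol s h g.
Proof.
move=> K0 hz hg zv; split.
  move=> T sT; apply: (abs_continuous_dominated (z := z) K0).
    by move=> r t sr rt _; exact: hz.
  by move=> i; have [+ _] := zv i; exact.
have : \forall t \ae @lebesgue_measure R,
    forall i, s < t -> is_derive t 1 (z i) (v i t).
  by apply: filter_forall => i; have [_] := zv i.
apply: (@filterS _ _ (ae_filter_ringOfSetsType _)) => t zt st.
by apply: hg => // i; exact: zt.
Qed.

Lemma caratheodory_solD (R : realType) (V : normedModType R) (s : R)
    (z1 v1 z2 v2 : R -> V) :
  caratheodory_sol s z1 v1 -> caratheodory_sol s z2 v2 ->
  caratheodory_sol s (fun t => z1 t + z2 t) (fun t => v1 t + v2 t).
Proof.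
move=> zv1 zv2.
apply: (@caratheodory_sol_dominated _ _ _ bool s 1
  (fun b => if b then z1 else z2) (fun b => if b then v1 else v2)) => //.
- by move=> r t _ _; rewrite mul1r big_bool/= opprD addrACA ler_normD.
- move=> t _ zt; exact: (is_deriveD (zt true) (zt false)).
- by case.
Qed.

Lemma caratheodory_solZ (R : realType) (V : normedModType R) (s c : R)
    (z v : R -> V) : caratheodory_sol s z v ->
  caratheodory_sol s (fun t => c *: z t) (fun t => c *: v t).
Proof.
move=> zv.
apply: (@caratheodory_sol_dominated _ _ _ unit s `|c| (fun=> z) (fun=> v)) => //.
- move=> r t _ _; rewrite (bigD1 tt)//= -scalerBr normrZ ler_wpM2l//.
  by rewrite ler_wpDr ?sumr_ge0.
- by move=> t _ /(_ tt) zt; exact: is_deriveZ.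
Qed.

Lemma caratheodory_sol_sum (R : realType) (V : normedModType R)
    (n : nat) (s : R) (z v : 'I_n -> R -> V) :
  (forall i, caratheodory_sol s (z i) (v i)) ->
  caratheodory_sol s (fun t => \sum_i z i t) (fun t => \sum_i v i t).
Proof.
apply: (@caratheodory_sol_dominated _ _ _ _ _ 1) => //.
- by move=> r t _ _; rewrite -sumrB mul1r ler_norm_sum.
- move=> t _ zt; have := is_derive_sum zt.
  by congr (is_derive _ _ _ _); apply/funext => r; rewrite fct_sumE.
Qed.

Lemma is_derive_entry (R : realType) (m n : nat) (M : R -> 'M[R]_(m, n)) (t : R)
    (A : 'M[R]_(m, n)) i j :
  is_derive t 1 M A -> is_derive t 1 (fun r => M r i j) (A i j).
Proof.
move=> [dM <-]; apply: DeriveDef; first by move/derivable_mxP : dM; exact.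
by rewrite derive_mx// mxE.
Qed.

Lemma normr_entry_le (R : realType) (m n : nat) (A : 'M[R]_(m, n)) i j :
  `|A i j| <= `|A|.
Proof.
rewrite [leRHS]/Num.Def.normr/= mx_normrE.
by apply: le_trans; last exact: (le_bigmax _ _ (i, j)).
Qed.

Lemma caratheodory_sol_entry (R : realType) (m n : nat) (s : R)
    (z v : R -> 'M[R]_(m, n)) i j : caratheodory_sol s z v ->
  caratheodory_sol s (fun t => z t i j) (fun t => v t i j).
Proof.
move=> zv.
apply: (@caratheodory_sol_dominated _ _ _ unit s 1 (fun=> z) (fun=> v)) => //.
  move=> r t _ _; rewrite mul1r (bigD1 tt)//= ler_wpDr ?sumr_ge0//.
  by have := normr_entry_le (z t - z r) i j; rewrite !mxE.
by move=> t _ /(_ tt) zt; exact: is_derive_entry.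
Qed.

Lemma caratheodory_sol_shift (R : realType) (V : normedModType R) (s s' : R)
    (z v : R -> V) : s <= s' -> caratheodory_sol s z v ->
  caratheodory_sol s' z v.
Proof.
move=> ss' [zac zv]; split.
  move=> T s'T e e0; have [delta d0 H] := zac T (le_trans ss' s'T) e e0.
  exists delta => // u /allP us'; apply: H; apply/allP => I /us'.
  by move=> /and3P[/(le_trans ss') -> -> ->].
apply: (@filterS _ _ (ae_filter_ringOfSetsType _)) zv => t + s't; apply.
exact: le_lt_trans s't.
Qed.

Lemma eq_caratheodory_sol (R : realType) (V : normedModType R) (s : R)
    (z v v' : R -> V) : (forall t, s < t -> v t = v' t) ->
  caratheodory_sol s z v -> caratheodory_sol s z v'.
Proof.
move=> vv' [zac zv]; split=> //.
by apply: (@filterS _ _ (ae_filter_ringOfSetsType _)) zv => t + st; rewrite -vv'//; exact.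
Qed.

(** The one-sided, division-free form of differentiability in which the
comparison lemma consumes derivatives. *)
Lemma is_derive_near (R : realType) (f : R -> R) (t l e : R) :
  is_derive t 1 f l -> 0 < e ->
  \forall h \near 0^'+, `|f (t + h) - f t - h * l| <= e * h.
Proof.
move=> [df <-] e0.
have /cvgrPdist_le/(_ _ e0) := df; rewrite near_withinE => dfe.
have H : \forall h \near 0^'+, `|'D_1 f t - h^-1 *: (f (h + t) - f t)| <= e.
  rewrite near_withinE; apply: filterS dfe => h + h0.
  by rewrite gt_eqF// /= [h *: 1]mulr1; exact.
near=> h.
have h0 : 0 < h by near: h; exact: nbhs_right_gt.
have : `|'D_1 f t - h^-1 *: (f (h + t) - f t)| <= e by near: h.
rewrite -(ler_pM2r h0); congr (_ <= _).
rewrite -[X in _ * X = _](gtr0_norm h0) -normrM distrC; congr (`|_|).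
by rewrite [h + t]addrC /GRing.scale/=; field; rewrite gt_eqF.
Unshelve. all: by end_near. Qed.

Lemma caratheodory_sol_id (R : realType) (s : R) :
  caratheodory_sol s (fun t : R => t) (fun=> 1).
Proof.
split.
  move=> T _ e e0; exists e => // u /allP uT _.
  congr (_ < _); rewrite !big_seq; apply: eq_bigr => I /uT/and3P[_ I12 _].
  by rewrite ger0_norm// subr_ge0 ltW.
by apply: aeW => t _; exact: is_derive_id.
Qed.

(** The bound [c] may be negative, whereas majorants are nondecreasing; hence
the slope [c] is first subtracted from [f], and the majorant is constant. *)
Lemma caratheodory_sol_le (R : realType) (f g : R -> R) (s T c : R) : s <= T ->
  caratheodory_sol s f g -> (forall t, s < t -> t < T -> g t <= c) ->
  f T - f s <= c * (T - s).
Proof.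
move=> sT fg gc.
have [hac hd] := caratheodory_solD fg (caratheodory_solZ (- c) (caratheodory_sol_id s)).
have := abs_continuous_le (U := cst 0) sT (hac T sT).
rewrite subrr => H.
suff : f T + - c *: T - (f s + - c *: s) <= 0.
  by rewrite /GRing.scale/=; lra.
apply: H => //.
apply: (@filterS _ _ (ae_filter_ringOfSetsType _)) hd => t /= ht st tT e e0.
have {}ht := is_derive_near (ht st) e0.
near=> h => /=.
have h0 : 0 < h by near: h; exact: nbhs_right_gt.
have : `|f (t + h) + - c *: (t + h) - (f t + - c *: t) - h * (g t + - c *: 1)|
  <= e * h by near: h.
move=> /(le_trans (ler_norm _)).
have : h * (g t + - c *: 1) <= 0.
  by rewrite pmulr_rle0// /GRing.scale/= mulr1 subr_le0 gc.
lra.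
Unshelve. all: by end_near. Qed.

(** * Contraction of the entrywise l1 norm by Laplacian flows *)

Definition l1norm (R : realType) (m n : nat) (A : 'M[R]_(m, n)) : R :=
  \sum_i \sum_j `|A i j|.

Lemma l1norm_ge0 (R : realType) m n (A : 'M[R]_(m, n)) : 0 <= l1norm A.
Proof. by apply: sumr_ge0 => i _; apply: sumr_ge0. Qed.

Lemma l1norm0 (R : realType) m n : l1norm (0 : 'M[R]_(m, n)) = 0.
Proof.
by rewrite /l1norm big1// => i _; rewrite big1// => j _; rewrite mxE normr0.
Qed.

Lemma l1normD (R : realType) m n (A B : 'M[R]_(m, n)) :
  l1norm (A + B) <= l1norm A + l1norm B.
Proof.
rewrite /l1norm -big_split/=; apply: ler_sum => i _.
by rewrite -big_split/=; apply: ler_sum => j _; rewrite mxE ler_normD.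
Qed.

Lemma l1normZ (R : realType) m n (c : R) (A : 'M[R]_(m, n)) :
  l1norm (c *: A) = `|c| * l1norm A.
Proof.
rewrite /l1norm mulr_sumr; apply: eq_bigr => i _.
by rewrite mulr_sumr; apply: eq_bigr => j _; rewrite mxE normrM.
Qed.

Lemma l1normN (R : realType) m n (A : 'M[R]_(m, n)) : l1norm (- A) = l1norm A.
Proof. by rewrite -scaleN1r l1normZ normrN1 mul1r. Qed.

Lemma l1norm_entry_le (R : realType) m n (A : 'M[R]_(m, n)) i j :
  `|A i j| <= l1norm A.
Proof.
rewrite /l1norm (bigD1 i)//= (bigD1 j)//= -addrA lerDl addr_ge0//.
  exact: sumr_ge0.
by apply: sumr_ge0 => k _; exact: sumr_ge0.
Qed.

Lemma l1norm_mulmx_le (R : realType) (m n p : nat) (A : 'M[R]_(m, n))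
    (B : 'M[R]_(n, p)) (c : R) : (forall j, \sum_i `|A i j| <= c) ->
  l1norm (A *m B) <= c * l1norm B.
Proof.
move=> Ac.
apply: (@le_trans _ _ (\sum_i \sum_j \sum_k `|A i k| * `|B k j|)).
  apply: ler_sum => i _; apply: ler_sum => j _; rewrite mxE.
  by rewrite (le_trans (ler_norm_sum _ _ _))//; under eq_bigr do rewrite normrM.
under eq_bigr do rewrite exchange_big/=.
rewrite exchange_big/= /l1norm mulr_sumr; apply: ler_sum => k _.
rewrite exchange_big/= mulr_sumr; apply: ler_sum => j _.
by rewrite -mulr_suml ler_wpM2r.
Qed.

Lemma l1norm_stochastic_mulmx (R : realType) (n p : nat) (A : 'M[R]_n)
    (B : 'M[R]_(n, p)) : column_stochastic A -> l1norm (A *m B) <= l1norm B.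
Proof.
move=> [A0 A1]; rewrite -[leRHS]mul1r; apply: l1norm_mulmx_le => j.
by rewrite -(A1 j); apply: ler_sum => i _; rewrite ger0_norm.
Qed.

(** Off the diagonal the signs are those of the Laplacian, on the diagonal
smallness of [h] takes over, and the columns of [A] sum to zero. *)
Lemma laplacian_euler_stochastic (R : realType) (n : nat) (A : 'M[R]_n) (h : R) :
  generalized_laplacian A -> 0 <= h -> (forall i, h * A i i <= 1) ->
  column_stochastic (1%:M - h *: A).
Proof.
move=> [Aoff Asum] h0 hA; split=> [i j|j].
  rewrite !mxE; have [->|ij] := eqVneq i j; first by rewrite subr_ge0.
  by rewrite add0r -mulrN mulr_ge0// oppr_ge0 Aoff.
under eq_bigr do rewrite !mxE.
rewrite sumrB -mulr_sumr Asum mulr0 subr0 (bigD1 j)//= eqxx.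
by rewrite big1 ?addr0// => i /negbTE ->.
Qed.

(** To first order [z(t + h) = (1 - h L) z(t) + h v(t)], and the first term is
a stochastic matrix applied to [z(t)]; hence the right difference quotients of
[l1norm] along the solution are at most [l1norm (v t)] in the limit. Working
with the Euler step avoids differentiating absolute values. *)
Lemma laplacian_flow_l1_le (R : realType) (n m : nat) (L : R -> 'M[R]_n)
    (z v : R -> 'M[R]_(n, m)) (U U' : R -> R) (s T : R) : 0 <= s -> s <= T ->
  (forall t, 0 <= t -> generalized_laplacian (L t)) ->
  (forall i j, caratheodory_sol s (fun t => z t i j)
    (fun t => (- (L t *m z t) + v t) i j)) ->
  (forall r t, s <= r -> r <= t -> t <= T -> U r <= U t) ->
  (forall t, s < t -> t < T -> is_derive t 1 U (U' t) /\ l1norm (v t) <= U' t) ->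
  l1norm (z T) - l1norm (z s) <= U T - U s.
Proof.
move=> s0 sT Llap zv Und UU'.
apply: (abs_continuous_le (f := fun t => l1norm (z t)) sT) => //.
  apply: (@abs_continuous_dominated _ _ _ ('I_n * 'I_m)%type _ _ 1
    (fun ij t => z t ij.1 ij.2)) => //; last first.
    by move=> [i j]; have [+ _] := zv i j; exact.
  move=> r t _ _ _; rewrite mul1r /l1norm !pair_bigA/= -sumrB.
  rewrite (le_trans (ler_norm_sum _ _ _))//; apply: ler_sum => -[i j] _.
  exact: ler_dist_dist.
have : \forall t \ae @lebesgue_measure R, forall ij : 'I_n * 'I_m, s < t ->
    is_derive t 1 (fun t => z t ij.1 ij.2) ((- (L t *m z t) + v t) ij.1 ij.2).
  by apply: filter_forall => -[i j]; have [_] := zv i j.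
apply: (@filterS _ _ (ae_filter_ringOfSetsType _)) => t zt st tT e e0.
have t0 : 0 <= t by rewrite (le_trans s0)// ltW.
pose N : R := (n * m)%:R + 1.
have N0 : 0 < N by rewrite ltr_wpDl.
have eN0 : 0 < e / N by rewrite divr_gt0.
have [dU vU] := UU' t st tT.
have nearU := is_derive_near dU eN0.
have nearz : \forall h \near 0^'+, forall ij : 'I_n * 'I_m,
    `|z (t + h) ij.1 ij.2 - z t ij.1 ij.2
      - h * (- (L t *m z t) + v t) ij.1 ij.2| <= e / N * h.
  by apply: filter_forall => ij; exact: is_derive_near (zt ij st) eN0.
have nearL : \forall h \near 0^'+, forall i : 'I_n, h * L t i i <= 1.
  apply: filter_forall => i; near=> h.
  have h0 : 0 < h by near: h; exact: nbhs_right_gt.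
  apply: (@le_trans _ _ (h * (1 + `|L t i i|))).
    by rewrite ler_pM2l// ler_wpDl// ler_norm.
  rewrite -ler_pdivlMr ?ltr_pwDl// mul1r; near: h.
  by apply: nbhs_right_le; rewrite invr_gt0 ltr_pwDl.
near=> h.
have h0 : 0 < h by near: h; exact: nbhs_right_gt.
have : `|U (t + h) - U t - h * U' t| <= e / N * h by near: h.
rewrite -normrN => /(le_trans (ler_norm _)) HU.
have Hz : forall ij : 'I_n * 'I_m,
    `|z (t + h) ij.1 ij.2 - z t ij.1 ij.2
      - h * (- (L t *m z t) + v t) ij.1 ij.2| <= e / N * h by near: h.
have HL : forall i : 'I_n, h * L t i i <= 1 by near: h.
set w := z (t + h) - z t - h *: (- (L t *m z t) + v t).
have Hw : l1norm w <= (n * m)%:R * (e / N * h).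
  rewrite /l1norm pair_bigA/=.
  apply: (@le_trans _ _ (\sum_(ij : 'I_n * 'I_m) e / N * h)).
    by apply: ler_sum => ij _; have := Hz ij; rewrite !mxE.
  by rewrite sumr_const card_prod !card_ord mulr_natl.
have zE : z (t + h) = (1%:M - h *: L t) *m z t + (h *: v t + w).
  rewrite /w mulmxBl mul1mx -scalemxAl scalerDr scalerN.
  by apply/matrixP => i j; rewrite !mxE; ring.
have H1 : l1norm (z (t + h)) <= l1norm (z t) + (h * l1norm (v t) + l1norm w).
  rewrite zE (le_trans (l1normD _ _))// lerD//.
    apply: l1norm_stochastic_mulmx.
    exact: laplacian_euler_stochastic (Llap _ t0) (ltW h0) HL.
  by rewrite (le_trans (l1normD _ _))// l1normZ gtr0_norm.
have H2 : h * l1norm (v t) <= h * U' t by rewrite ler_pM2l.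
have H3 : e * h = (n * m)%:R * (e / N * h) + e / N * h.
  have NE : e = e / N * N by rewrite mulfVK// gt_eqF.
  by rewrite {1}NE /N; ring.
lra.
Unshelve. all: by end_near. Qed.

(** * Euclidean and operator norms; zero-sum vectors under an ergodic flow *)

Lemma l2norm_ge0 (R : realType) (k : nat) (v : 'rV[R]_k) : 0 <= l2norm v.
Proof. exact: sqrtr_ge0. Qed.

Lemma sqr_l2norm (R : realType) (k : nat) (v : 'rV[R]_k) :
  l2norm v ^+ 2 = \sum_j v 0 j ^+ 2.
Proof. by rewrite sqr_sqrtr// sumr_ge0// => j _; rewrite sqr_ge0. Qed.

Lemma l2norm_entry_le (R : realType) (k : nat) (v : 'rV[R]_k) j :
  `|v 0 j| <= l2norm v.
Proof.
rewrite -(@ler_pXn2r _ 2)// ?nnegrE ?l2norm_ge0// sqr_l2norm real_normK ?num_real//.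
by rewrite (bigD1 j)//= lerDl sumr_ge0// => i _; rewrite sqr_ge0.
Qed.

Lemma l2norm_le_l1norm (R : realType) (k : nat) (v : 'rV[R]_k) :
  l2norm v <= \sum_j `|v 0 j|.
Proof.
rewrite -(@ler_pXn2r _ 2)// ?nnegrE ?l2norm_ge0 ?sumr_ge0// sqr_l2norm.
rewrite expr2 mulr_suml; apply: ler_sum => j _.
rewrite -normr_id -(@real_normK _ (v 0 j)) ?num_real// expr2 normr_id ler_wpM2l//.
by rewrite (bigD1 j)//= lerDl sumr_ge0.
Qed.

(** Expand the sum of the squares of [b u_j - a v_j], with [a] and [b] the
norms of [u] and [v]. *)
Lemma l2norm_cauchy_schwarz (R : realType) (k : nat) (u v : 'rV[R]_k) :
  \sum_j u 0 j * v 0 j <= l2norm u * l2norm v.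
Proof.
set a := l2norm u; set b := l2norm v.
have [ab0|] := ltP 0 (a * b); last first.
  move=> ab; have {ab} : a * b == 0.
    by rewrite eq_le ab mulr_ge0 ?l2norm_ge0.
  rewrite mulf_eq0 => /orP[/eqP a0|/eqP b0].
    rewrite a0 mul0r big1// => j _.
    by have := l2norm_entry_le u j; rewrite -/a a0 normr_le0 => /eqP ->; rewrite mul0r.
  rewrite b0 mulr0 big1// => j _.
  by have := l2norm_entry_le v j; rewrite -/b b0 normr_le0 => /eqP ->; rewrite mulr0.
have : 0 <= \sum_j (b * u 0 j - a * v 0 j) ^+ 2.
  by apply: sumr_ge0 => j _; rewrite sqr_ge0.
have -> : \sum_j (b * u 0 j - a * v 0 j) ^+ 2 =
    2 * (a * b) * (a * b - \sum_j u 0 j * v 0 j).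
  transitivity (b ^+ 2 * (\sum_j u 0 j ^+ 2)
      + a ^+ 2 * (\sum_j v 0 j ^+ 2) - 2 * a * b * \sum_j u 0 j * v 0 j).
    rewrite !mulr_sumr -big_split/= -sumrB; apply: eq_bigr => j _; ring.
  rewrite -!sqr_l2norm -/a -/b; ring.
by rewrite pmulr_rge0 ?subr_ge0// mulr_gt0.
Qed.

Lemma l2normD (R : realType) (k : nat) (u v : 'rV[R]_k) :
  l2norm (u + v) <= l2norm u + l2norm v.
Proof.
rewrite -(@ler_pXn2r _ 2)// ?nnegrE ?addr_ge0 ?l2norm_ge0//.
rewrite sqrrD !sqr_l2norm.
have -> : \sum_j (u + v) 0 j ^+ 2 = \sum_j u 0 j ^+ 2 +
    (\sum_j u 0 j * v 0 j) *+ 2 + \sum_j v 0 j ^+ 2.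
  rewrite -sumrMnl -!big_split/=; apply: eq_bigr => j _.
  by rewrite mxE sqrrD.
by rewrite lerD2r lerD2l lerMn2r/= l2norm_cauchy_schwarz.
Qed.

Lemma l2norm_mulmx_le (R : realType) (m n : nat) (A : 'M[R]_(m, n)) (z : 'cV[R]_n) :
  l2norm z^T <= 1 -> l2norm (A *m z)^T <= l1norm A.
Proof.
move=> z1; rewrite (le_trans (l2norm_le_l1norm _))//.
apply: ler_sum => i _; rewrite !mxE (le_trans (ler_norm_sum _ _ _))//.
apply: ler_sum => j _; rewrite normrM ler_piMr//.
by have := l2norm_entry_le z^T j; rewrite mxE => /le_trans; exact.
Qed.

Lemma opnorm_has_sup (R : realType) (m n : nat) (A : 'M[R]_(m, n)) :
  has_sup [set l2norm (A *m z)^T | z in [set z : 'cV[R]_n | l2norm z^T <= 1]].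
Proof.
split.
  exists (l2norm (A *m (0 : 'cV[R]_n))^T); exists 0 => //=.
  by rewrite trmx0 (le_trans (l2norm_le_l1norm _))// big1// => j _; rewrite mxE normr0.
by exists (l1norm A) => _ [z /= z1 <-]; exact: l2norm_mulmx_le.
Qed.

Lemma opnorm_entry_le (R : realType) (m n : nat) (A : 'M[R]_(m, n)) i j :
  `|A i j| <= opnorm A.
Proof.
apply: (@le_trans _ _ (l2norm (A *m delta_mx j 0)^T)).
  have := l2norm_entry_le (A *m delta_mx j 0 : 'cV[R]_m)^T i.
  by rewrite -colE !mxE.
apply: sup_upper_bound; first exact: opnorm_has_sup.
exists (delta_mx j 0) => //=.
rewrite (le_trans (l2norm_le_l1norm _))// (bigD1 j)//= !mxE !eqxx/= normr1.
by rewrite big1 ?addr0// => k /negbTE kj; rewrite !mxE kj/= normr0.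
Qed.

Lemma opnorm_ge0 (R : realType) (m n : nat) (A : 'M[R]_(m, n)) : 0 <= opnorm A.
Proof.
apply: (@le_trans _ _ (l2norm (A *m (0 : 'cV[R]_n))^T)); first exact: l2norm_ge0.
apply: sup_upper_bound; first exact: opnorm_has_sup.
exists 0 => //=.
by rewrite trmx0 (le_trans (l2norm_le_l1norm _))// big1// => j _; rewrite mxE normr0.
Qed.

Lemma l1norm_le_opnorm (R : realType) (m n : nat) (A : 'M[R]_(m, n)) :
  l1norm A <= (m * n)%:R * opnorm A.
Proof.
apply: (@le_trans _ _ (\sum_(i < m) \sum_(j < n) opnorm A)).
  by apply: ler_sum => i _; apply: ler_sum => j _; exact: opnorm_entry_le.
by rewrite !sumr_const !card_ord mulr_natl mulrnA mulrnAC.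
Qed.

(** Gives the continuity of the operator norm, hence the integrability of the
discounted input. *)
Lemma opnorm_le_add_l1norm (R : realType) (m n : nat) (A B : 'M[R]_(m, n)) :
  opnorm A <= opnorm B + l1norm (A - B).
Proof.
apply: ge_sup; first by have [] := opnorm_has_sup A.
move=> _ [z /= z1 <-]; rewrite -[A in A *m z](subrKC B) mulmxDl linearD/=.
rewrite (le_trans (l2normD _ _))// lerD//; last exact: l2norm_mulmx_le.
by apply: sup_upper_bound; [exact: opnorm_has_sup|exists z].
Qed.

(** The row of ones is a left fixed vector of [B], so it spans the row space
of a rank-one [B]; thus [B] factors through the column sums of [D]. *)
Lemma rank1_stochastic_mulmx0 (R : realType) (n d : nat) (B : 'M[R]_n)
    (D : 'M[R]_(n, d)) : (0 < n)%N -> rank1_stochastic B ->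
  (forall j, \sum_i D i j = 0) -> B *m D = 0.
Proof.
move=> n0 [[B0 B1] rkB] D0.
pose o : 'rV[R]_n := const_mx 1.
have oB : (o <= B)%MS.
  apply/submxP; exists o; apply/matrixP => i j; rewrite !mxE.
  by under eq_bigr do rewrite mxE mul1r; rewrite B1.
have rko : \rank o = 1%N.
  apply/eqP; rewrite eqn_leq rank_leq_row lt0n mxrank_eq0.
  apply/eqP => /matrixP/(_ 0 (Ordinal n0)); rewrite !mxE.
  by move/eqP; rewrite oner_eq0.
have /submxP[X ->] : (B <= o)%MS.
  have := mxrank_leqif_eq oB; rewrite rkB rko => -[_].
  by rewrite eqxx => /esym/andP[].
rewrite -mulmxA (_ : o *m D = 0) ?mulmx0//.
apply/matrixP => i j; rewrite !mxE -[RHS](D0 j).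
by apply: eq_bigr => k _; rewrite mxE mul1r.
Qed.

(** Without a member, the infimum defining the distance to this set would
carry no information. *)
Lemma rank1_stochastic_nonempty (R : realType) (n : nat) : (0 < n)%N ->
  rank1_stochastic (const_mx n%:R^-1 : 'M[R]_n).
Proof.
move=> n0; have nn0 : n%:R != 0 :> R by rewrite pnatr_eq0 -lt0n.
split; first split=> [i j|j].
- by rewrite mxE invr_ge0.
- under eq_bigr do rewrite mxE.
  by rewrite sumr_const card_ord -[LHS]mulr_natl divff.
apply/eqP; rewrite eqn_leq lt0n mxrank_eq0; apply/andP; split.
  have -> : (const_mx n%:R^-1 : 'M[R]_n) =
      (const_mx n%:R^-1 : 'cV[R]_n) *m (const_mx 1 : 'rV[R]_n).
    by apply/matrixP => i j; rewrite !mxE big_ord1 !mxE mulr1.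
  by rewrite (leq_trans (mxrankM_maxl _ _))// rank_leq_col.
apply/eqP => /matrixP/(_ (Ordinal n0) (Ordinal n0)); rewrite !mxE.
by move/eqP; rewrite invr_eq0 (negbTE nn0).
Qed.

(** Subtracting a nearby rank-one stochastic matrix from the flow does not
change its action on [D]. Any factor less than one would serve as well as one
half. *)
Lemma ergodic_halves_zero_sum (R : realType) (n d : nat)
    (Phi : R -> R -> 'M[R]_n) : (0 < n)%N -> weakly_exp_ergodic Phi ->
  exists2 T : R, 0 < T & forall (s : R) (D : 'M[R]_(n, d)), 0 <= s ->
    (forall j, \sum_i D i j = 0) ->
    l1norm (Phi (s + T) s *m D) <= 2^-1 * l1norm D.
Proof.
move=> n0 [lam [a [/andP[lam0 lam1] a0 H]]].
(* A column of the difference of the two matrices has l1 norm at most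
   [n * (2 * a * lam ^+ N.+1)], the factor [2] giving room above the infimum. *)
pose eta : R := (n%:R * 2 * a * 2)^-1.
have nn0 : 0 < n%:R :> R by rewrite ltr0n.
have eta0 : 0 < eta by rewrite invr_gt0 !mulr_gt0.
have [N lamN] : exists N : nat, lam ^+ N.+1 <= eta.
  have /cvgrPdist_le/(_ _ eta0) : lam ^+ k @[k --> \oo] --> 0.
    by apply: cvg_expr; rewrite gtr0_norm.
  move=> -[k _ Hk]; exists k; have := Hk k.+1 (leqnSn k).
  by rewrite sub0r normrN ger0_norm// exprn_ge0// ltW.
exists N.+1%:R => // s D s0 D0.
have sT : s <= s + N.+1%:R by rewrite ler_wpDr.
have dist_lt : dist (Phi (s + N.+1%:R) s) (@rank1_stochastic R n)
    < 2 * a * lam ^+ N.+1.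
  apply: (le_lt_trans (H _ _ s0 sT)).
  rewrite (addrC s) addrK powR_mulrn ?ltW// ltr_pM2r ?exprn_gt0//.
  by rewrite ltr_pMl// ltrDl.
have [|_ [B rB <-] HB] := inf_lt _ dist_lt.
  by eexists; exists (const_mx n%:R^-1); [exact: rank1_stochastic_nonempty|].
rewrite -[Phi _ _](subrK B) mulmxDl (rank1_stochastic_mulmx0 n0 rB D0) addr0.
apply: l1norm_mulmx_le => j.
apply: (@le_trans _ _ (\sum_(i < n) (2 * a * lam ^+ N.+1))).
  apply: ler_sum => i _; apply: le_trans (ltW HB).
  exact: opnorm_entry_le.
rewrite sumr_const card_ord -[leLHS]mulr_natl.
apply: (@le_trans _ _ (n%:R * (2 * a * eta))).
  by rewrite ler_pM2l// ler_pM2l// mulr_gt0.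
rewrite /eta le_eqVlt; apply/orP; left; apply/eqP; field.
by rewrite !gt_eqF.
Qed.

(** * States and weights of the push-sum dynamics *)

Definition weights (R : realType) (n : nat)
    (w : wstate R (fun _ : 'I_n => 1%N)) : 'cV[R]_n := \col_i w i 0 0.

(** The numerators of the tracking errors: row [i] is [w_i (y_i - avg x)]. *)
Definition disagreement (R : realType) (n d : nat) (x : 'M[R]_(n, d))
    (w : wstate R (fun _ : 'I_n => 1%N)) : 'M[R]_(n, d) :=
  x - weights w *m avg x.

(** [U] is a primitive of a bound on the size of the input; increments of [U]
will bound all effects of the input on the state. *)
Definition input_majorant (R : realType) (n d : nat) (u : R -> 'M[R]_(n, d))
    (s T : R) (U U' : R -> R) : Prop :=
  (forall r t, s <= r -> r <= t -> t <= T -> U r <= U t) /\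
  (forall t, s < t -> t < T -> is_derive t 1 U (U' t) /\ l1norm (u t) <= U' t).

Lemma avgE (R : realType) (n d : nat) (x : 'M[R]_(n, d)) i j :
  avg x i j = n%:R^-1 * \sum_k x k j.
Proof.
rewrite !mxE summxE; congr (_ * _).
by apply: eq_bigr => k _; rewrite mxE.
Qed.

Lemma sum_avg (R : realType) (n d : nat) (x : 'M[R]_(n, d)) j : (0 < n)%N ->
  n%:R * avg x 0 j = \sum_k x k j.
Proof. by move=> n0; rewrite avgE mulVKf// pnatr_eq0 -lt0n. Qed.

Lemma pushsum_x_sol (R : realType) (n d : nat) (L : R -> 'M[R]_n)
    (u x : R -> 'M[R]_(n, d)) (w : R -> wstate R (fun _ : 'I_n => 1%N)) i j :
  trajectory (pushsum d L) u x w ->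
  caratheodory_sol 0 (fun t => x t i j) (fun t => (- (L t *m x t) + u t) i j).
Proof.
move=> /(_ i)[/(caratheodory_sol_entry 0 j) H _]; move: H.
rewrite (_ : (fun t => row i (x t) 0 j) = (fun t => x t i j)); last first.
  by apply/funext => t; rewrite mxE.
by apply: eq_caratheodory_sol => t _; rewrite /= !mxE.
Qed.

Lemma pushsum_w_sol (R : realType) (n d : nat) (L : R -> 'M[R]_n)
    (u x : R -> 'M[R]_(n, d)) (w : R -> wstate R (fun _ : 'I_n => 1%N)) i j :
  trajectory (pushsum d L) u x w ->
  caratheodory_sol 0 (fun t => weights (w t) i j)
    (fun t => (- (L t *m weights (w t))) i j).
Proof.
move=> /(_ i)[_ /(caratheodory_sol_entry 0 0) H]; move: H.
rewrite (_ : (fun t => w t i 0 0) = (fun t => weights (w t) i j)); last first.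
  by apply/funext => t; rewrite mxE.
apply: eq_caratheodory_sol => t _; rewrite /= !mxE summxE; congr (- _).
by apply: eq_bigr => k _; rewrite !mxE.
Qed.

Lemma flow_mulmx_sol (R : realType) (n m : nat) (L : R -> 'M[R]_n)
    (Phi : R -> R -> 'M[R]_n) (s : R) (C : 'M[R]_(n, m)) i j :
  is_flow L Phi -> 0 <= s ->
  caratheodory_sol s (fun t => (Phi t s *m C) i j)
    (fun t => (- (L t *m (Phi t s *m C))) i j).
Proof.
move=> flow s0; have [_ H] := flow s s0.
have := caratheodory_sol_sum (fun k : 'I_n =>
  caratheodory_solZ (C k j) (caratheodory_sol_entry i k H)).
rewrite (_ : (fun t => \sum_(k < n) _) = (fun t => (Phi t s *m C) i j)); last first.
  by apply/funext => t; rewrite mxE; apply: eq_bigr => k _; exact: mulrC.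
apply: eq_caratheodory_sol => t _.
by rewrite mulmxA -mulNmx mxE; apply: eq_bigr => k _; rewrite mulNmx; exact: mulrC.
Qed.

Lemma avg_sol (R : realType) (n d : nat) (L : R -> 'M[R]_n)
    (u x : R -> 'M[R]_(n, d)) (w : R -> wstate R (fun _ : 'I_n => 1%N)) :
  (forall t, 0 <= t -> generalized_laplacian (L t)) ->
  trajectory (pushsum d L) u x w ->
  caratheodory_sol 0 (fun t => avg (x t)) (fun t => avg (u t)).
Proof.
move=> Llap xw.
have := caratheodory_solZ n%:R^-1 (caratheodory_sol_sum (fun i => (xw i).1)).
apply: eq_caratheodory_sol => t /ltW /Llap [_ L1] /=.
rewrite big_split/= scalerDr [X in X + _](_ : _ = 0) ?add0r//.
apply/eqP; rewrite scaler_eq0; apply/orP; right; apply/eqP.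
apply/matrixP => i j; rewrite summxE mxE.
transitivity (- \sum_k \sum_i L t i k * x t k j).
  rewrite exchange_big/= -sumrN; apply: eq_bigr => k _; rewrite ord1 !mxE.
  by congr (- _).
by rewrite big1 ?oppr0// => k _; rewrite -mulr_suml L1 mul0r.
Qed.

(** Applied to the difference of two solutions: by the contraction with zero
input, its size does not increase. *)
Lemma laplacian_flow_unique (R : realType) (n m : nat) (L : R -> 'M[R]_n)
    (z : R -> 'M[R]_(n, m)) (s T : R) : 0 <= s -> s <= T ->
  (forall t, 0 <= t -> generalized_laplacian (L t)) ->
  (forall i j, caratheodory_sol s (fun t => z t i j)
    (fun t => (- (L t *m z t)) i j)) -> z s = 0 -> z T = 0.
Proof.
move=> s0 sT Llap zL zs.
have := @laplacian_flow_l1_le _ _ _ L z (cst 0) (cst 0) (cst 0) _ _ s0 sT Llap.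
rewrite zs subrr => H.
have l0 := l1norm0 R n m.
apply/matrixP => i j; apply/eqP; rewrite mxE -normr_le0.
apply: le_trans (l1norm_entry_le (z T) i j) _.
rewrite l0 subr0 in H; apply: H => //.
- by move=> i' j'; apply: eq_caratheodory_sol (zL i' j') => t _; rewrite addr0.
- by move=> t _ _; split; [exact: is_derive_cst|exact: lexx].
Qed.

Lemma weights_flow (R : realType) (n d : nat) (L : R -> 'M[R]_n)
    (Phi : R -> R -> 'M[R]_n) (u x : R -> 'M[R]_(n, d))
    (w : R -> wstate R (fun _ : 'I_n => 1%N)) (t : R) :
  (forall t, 0 <= t -> generalized_laplacian (L t)) -> is_flow L Phi ->
  trajectory (pushsum d L) u x w -> unit_weights (x 0, w 0) -> 0 <= t ->
  weights (w t) = Phi t 0 *m const_mx 1.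
Proof.
move=> Llap flow xw w0 t0.
have := @laplacian_flow_unique _ _ _ L
  (fun t => weights (w t) - Phi t 0 *m const_mx 1) _ _ (lexx 0) t0 Llap.
move=> H; apply/eqP; rewrite -subr_eq0; apply/eqP; apply: H.
  move=> i j.
  have H := caratheodory_solD (pushsum_w_sol i j xw)
    (caratheodory_solZ (-1) (flow_mulmx_sol (const_mx 1 : 'cV[R]_n) i j flow (lexx 0))).
  move: H; rewrite (_ : (fun t => _ + _) = (fun t =>
    (weights (w t) - Phi t 0 *m const_mx 1) i j)); last first.
    apply/funext => r; move: (weights (w r)) (Phi r 0 *m _) => A B.
    by rewrite scaleN1r !mxE.
  apply: eq_caratheodory_sol => r _.
  rewrite scaleN1r mulmxBr; move: (L r *m weights (w r)) (L r *m (_ *m _)) => A B.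
  by rewrite !mxE; ring.
have [-> _] := flow 0 (lexx 0); rewrite mul1mx.
have w01 : forall i, w 0 i = const_mx 1 := w0.
by apply/matrixP => i j; rewrite !mxE w01 mxE subrr.
Qed.

(** The column sums of [L] vanish, so the total weight has zero derivative
almost everywhere; the comparison is used for it and for its opposite. *)
Lemma sum_weights (R : realType) (n d : nat) (L : R -> 'M[R]_n)
    (u x : R -> 'M[R]_(n, d))
    (w : R -> wstate R (fun _ : 'I_n => 1%N)) (t : R) :
  (forall t, 0 <= t -> generalized_laplacian (L t)) ->
  trajectory (pushsum d L) u x w -> unit_weights (x 0, w 0) -> 0 <= t ->
  \sum_i weights (w t) i 0 = n%:R.
Proof.
move=> Llap xw w0 t0.
have H := caratheodory_sol_sum (fun i => pushsum_w_sol i 0 xw).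
have {}H : caratheodory_sol 0 (fun t => \sum_i weights (w t) i 0) (fun=> 0).
  apply: eq_caratheodory_sol H => r /ltW /Llap [_ L1].
  transitivity (- \sum_k \sum_i L r i k * weights (w r) k 0).
    rewrite exchange_big -sumrN; apply: eq_bigr => k _; rewrite mxE.
    by congr (- _); rewrite mxE.
  by rewrite big1 ?oppr0// => k _; rewrite -mulr_suml L1 mul0r.
have sum0 : \sum_i weights (w 0) i 0 = n%:R.
  have w01 : forall i, w 0 i = const_mx 1 := w0.
  under eq_bigr do rewrite mxE w01 mxE.
  by rewrite sumr_const card_ord.
have := caratheodory_sol_le (c := 0) t0 H (fun _ _ _ => lexx _).
have H' := caratheodory_solZ (-1) H.
have := caratheodory_sol_le (c := 0) t0 H' _.
rewrite /GRing.scale/= mulr0 => /(_ (fun _ _ _ => lexx _)).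
rewrite sum0; lra.
Qed.

(** * Growth and contraction of the disagreement *)

Lemma caratheodory_sol_subcst (R : realType) (V : normedModType R) (s : R)
    (z v : R -> V) (c : V) : caratheodory_sol s z v ->
  caratheodory_sol s (fun t => z t - c) v.
Proof.
move=> zv.
apply: (@caratheodory_sol_dominated _ _ _ unit s 1 (fun=> z) (fun=> v)) => //.
- move=> r t _ _; rewrite mul1r (bigD1 tt)//= opprB addrA subrK.
  by rewrite ler_wpDr ?sumr_ge0.
- move=> t _ /(_ tt) zt; have := is_deriveB zt (is_derive_cst c t 1).
  by rewrite subr0.
Qed.

Lemma l1norm_avg_le (R : realType) (n d : nat) (A : 'M[R]_(n, d)) :
  (0 < n)%N -> l1norm (avg A) <= l1norm A.
Proof.
move=> n0; rewrite /l1norm big_ord1 exchange_big/=; apply: ler_sum => j _.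
rewrite avgE normrM gtr0_norm ?invr_gt0 ?ltr0n// ler_pdivrMl ?ltr0n//.
rewrite (le_trans (ler_norm_sum _ _ _))// ler_peMl ?sumr_ge0//.
by rewrite ler1n.
Qed.

(** The average solves an equation of the same form with one agent and zero
Laplacian, so that the contraction lemma applies to it. *)
Lemma avg_increment_le (R : realType) (n d : nat) (L : R -> 'M[R]_n)
    (u x : R -> 'M[R]_(n, d)) (w : R -> wstate R (fun _ : 'I_n => 1%N))
    (s t : R) (U U' : R -> R) : (0 < n)%N ->
  (forall t, 0 <= t -> generalized_laplacian (L t)) ->
  trajectory (pushsum d L) u x w -> 0 <= s -> s <= t ->
  input_majorant u s t U U' ->
  l1norm (avg (x t) - avg (x s)) <= U t - U s.
Proof.
move=> n0 Llap xw s0 st [Und UU'].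
have := @laplacian_flow_l1_le _ 1 d (fun=> 0) (fun r => avg (x r) - avg (x s))
  (fun r => avg (u r)) U U' s t s0 st.
rewrite subrr => H.
have l0 := l1norm0 R 1 d.
rewrite l0 subr0 in H; apply: H => //.
- move=> r _; split=> [i j _|j]; first by rewrite mxE.
  by rewrite big1// => i _; rewrite mxE.
- move=> i j.
  have H := caratheodory_sol_entry i j (caratheodory_sol_subcst (avg (x s))
    (caratheodory_sol_shift s0 (avg_sol Llap xw))).
  by apply: eq_caratheodory_sol H => r _; rewrite mul0mx oppr0 add0r.
- move=> r sr rt; have [dU ur] := UU' r sr rt; split => //.
  by apply: le_trans ur; exact: l1norm_avg_le.
Qed.

Lemma disagreement_zero_sum (R : realType) (n d : nat) (L : R -> 'M[R]_n)
    (u x : R -> 'M[R]_(n, d)) (w : R -> wstate R (fun _ : 'I_n => 1%N)) (t : R) j :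
  (0 < n)%N -> (forall t, 0 <= t -> generalized_laplacian (L t)) ->
  trajectory (pushsum d L) u x w -> unit_weights (x 0, w 0) -> 0 <= t ->
  \sum_i disagreement (x t) (w t) i j = 0.
Proof.
move=> n0 Llap xw w0 t0.
transitivity (\sum_i (x t i j - weights (w t) i 0 * avg (x t) 0 j)).
  apply: eq_bigr => i _; rewrite /disagreement.
  by move: (weights _) (avg _) => a b; rewrite !mxE big_ord1.
by rewrite sumrB -mulr_suml (sum_weights Llap xw w0 t0) sum_avg// subrr.
Qed.

(** Freezing the average at a constant [c] turns the disagreement into a
linear combination of solutions. *)
Lemma recentered_sol (R : realType) (n d : nat) (L : R -> 'M[R]_n)
    (u x : R -> 'M[R]_(n, d)) (w : R -> wstate R (fun _ : 'I_n => 1%N))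
    (s : R) (c : 'rV[R]_d) i j : trajectory (pushsum d L) u x w -> 0 <= s ->
  caratheodory_sol s (fun t => (x t - weights (w t) *m c) i j)
    (fun t => (- (L t *m (x t - weights (w t) *m c)) + u t) i j).
Proof.
move=> xw s0.
have := caratheodory_solD (pushsum_x_sol i j xw)
  (caratheodory_solZ (- c 0 j) (pushsum_w_sol i 0 xw)).
move=> /(caratheodory_sol_shift s0).
rewrite (_ : (fun t => _ + _) =
    (fun t => (x t - weights (w t) *m c) i j)); last first.
  apply/funext => t; move: (weights _) => a.
  by rewrite !mxE big_ord1 /GRing.scale/= mulNr mulrC.
apply: eq_caratheodory_sol => t _; rewrite mulmxBr mulmxA.
move: (L t *m weights (w t)) (L t *m x t) => a b.
rewrite !mxE big_ord1 /GRing.scale/=; ring.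
Qed.

Lemma l1norm_weights_mulmx (R : realType) (n d : nat) (L : R -> 'M[R]_n)
    (u x : R -> 'M[R]_(n, d)) (w : R -> wstate R (fun _ : 'I_n => 1%N)) (t : R)
    (c : 'rV[R]_d) :
  (forall t, 0 <= t -> generalized_laplacian (L t)) ->
  trajectory (pushsum d L) u x w -> unit_weights (x 0, w 0) -> 0 <= t ->
  (forall i, 0 <= weights (w t) i 0) ->
  l1norm (weights (w t) *m c) <= n%:R * l1norm c.
Proof.
move=> Llap xw w0 t0 wt0; apply: l1norm_mulmx_le => j; rewrite ord1.
rewrite -(sum_weights Llap xw w0 t0).
by apply: ler_sum => i _; rewrite ger0_norm.
Qed.

(** The recentred state obeys the contraction lemma, and replacing the frozen
average by the current one costs at most [n] times its displacement, because
the weights sum to [n]. *)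
Lemma disagreement_le (R : realType) (n d : nat) (L : R -> 'M[R]_n)
    (u x : R -> 'M[R]_(n, d)) (w : R -> wstate R (fun _ : 'I_n => 1%N))
    (s t : R) (U U' : R -> R) : (0 < n)%N ->
  (forall t, 0 <= t -> generalized_laplacian (L t)) ->
  trajectory (pushsum d L) u x w -> unit_weights (x 0, w 0) ->
  (forall t, 0 <= t -> forall i, 0 <= weights (w t) i 0) ->
  0 <= s -> s <= t -> input_majorant u s t U U' ->
  l1norm (disagreement (x t) (w t)) <=
    l1norm (disagreement (x s) (w s)) + n.+1%:R * (U t - U s).
Proof.
move=> n0 Llap xw w0 wpos s0 st Uu.
have [Und UU'] := Uu.
have := @laplacian_flow_l1_le _ n d L
  (fun r => x r - weights (w r) *m avg (x s)) u U U' s t s0 st Llap.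
move=> /(_ (fun i j => recentered_sol (avg (x s)) i j xw s0) Und UU').
have t0 : 0 <= t by exact: le_trans st.
have := l1norm_weights_mulmx (avg (x t) - avg (x s)) Llap xw w0 t0 (wpos t t0).
have := avg_increment_le n0 Llap xw s0 st Uu.
rewrite -(@ler_pM2l _ n%:R) ?ltr0n//.
have := l1normD (x t - weights (w t) *m avg (x s))
  (- (weights (w t) *m (avg (x t) - avg (x s)))).
rewrite l1normN.
have -> : x t - weights (w t) *m avg (x s)
    - weights (w t) *m (avg (x t) - avg (x s)) = disagreement (x t) (w t).
  by rewrite mulmxBr opprB addrA subrK.
rewrite -/(disagreement (x s) (w s)) -natr1.
lra.
Qed.

(** Same comparison, for the recentred state minus its evolution under the
flow from time [s], which starts at zero. *)
Lemma disagreement_flow_le (R : realType) (n d : nat) (L : R -> 'M[R]_n)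
    (Phi : R -> R -> 'M[R]_n)
    (u x : R -> 'M[R]_(n, d)) (w : R -> wstate R (fun _ : 'I_n => 1%N))
    (s t : R) (U U' : R -> R) : (0 < n)%N ->
  (forall t, 0 <= t -> generalized_laplacian (L t)) -> is_flow L Phi ->
  trajectory (pushsum d L) u x w -> unit_weights (x 0, w 0) ->
  (forall t, 0 <= t -> forall i, 0 <= weights (w t) i 0) ->
  0 <= s -> s <= t -> input_majorant u s t U U' ->
  l1norm (disagreement (x t) (w t)) <=
    l1norm (Phi t s *m disagreement (x s) (w s)) + n.+1%:R * (U t - U s).
Proof.
move=> n0 Llap flow xw w0 wpos s0 st Uu.
have [Und UU'] := Uu.
set Ds := disagreement (x s) (w s).
have := @laplacian_flow_l1_le _ n d L
  (fun r => x r - weights (w r) *m avg (x s) - Phi r s *m Ds)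
  u U U' s t s0 st Llap.
have zsol i j : caratheodory_sol s
    (fun r => (x r - weights (w r) *m avg (x s) - Phi r s *m Ds) i j)
    (fun r => (- (L r *m (x r - weights (w r) *m avg (x s) - Phi r s *m Ds)) + u r) i j).
  have := caratheodory_solD (recentered_sol (avg (x s)) i j xw s0)
    (caratheodory_solZ (-1) (flow_mulmx_sol Ds i j flow s0)).
  rewrite (_ : (fun r => _ + _) =
      (fun r => (x r - weights (w r) *m avg (x s) - Phi r s *m Ds) i j)); last first.
    apply/funext => r; move: (x r - _) (Phi r s *m _) => a b.
    by rewrite scaleN1r !mxE.
  apply: eq_caratheodory_sol => r _; rewrite [in RHS]mulmxBr.
  move: (L r *m (_ - _)) (L r *m (Phi r s *m _)) => a b.
  by rewrite scaleN1r !mxE opprB opprK addrAC [X in X + _ = _]addrC.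
move=> /(_ zsol Und UU').
have [-> _] := flow s s0; rewrite mul1mx -/(disagreement (x s) (w s)) subrr.
rewrite l1norm0.
have t0 : 0 <= t by exact: le_trans st.
have := l1norm_weights_mulmx (avg (x t) - avg (x s)) Llap xw w0 t0 (wpos t t0).
have := avg_increment_le n0 Llap xw s0 st Uu.
rewrite -(@ler_pM2l _ n%:R) ?ltr0n//.
have := l1normD (x t - weights (w t) *m avg (x s) - Phi t s *m Ds)
  (- (weights (w t) *m (avg (x t) - avg (x s)))).
have := l1normD (x t - weights (w t) *m avg (x s) - Phi t s *m Ds
  - (weights (w t) *m (avg (x t) - avg (x s)))) (Phi t s *m Ds).
rewrite l1normN.
have -> : x t - weights (w t) *m avg (x s) - Phi t s *m Ds
    - weights (w t) *m (avg (x t) - avg (x s)) + Phi t s *m Ds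
    = disagreement (x t) (w t).
  by rewrite (mulmxBr (weights (w t))) addrAC subrK opprB addrA subrK.
rewrite -natr1.
lra.
Qed.

(** * The three defining properties of a flow tracker *)

(** Column [j] of row [i] of [L] is zero, so the maps do not change with [x_j]
and [w_j]. *)
Lemma pushsum_local (R : realType) (n d : nat) (L : R -> 'M[R]_n) :
  local_on_graph (pushsum d L) (laplacian_graph L).
Proof.
move=> t i j t0; rewrite negb_or negbK => /andP[ij /eqP Lij] x w ui.
have constP (V W : normedModType R) (f : V -> W) z :
    (forall v v', f v = f v') -> is_diff z f (cst 0).
  move=> ff; rewrite (_ : f = cst (f 0)); first exact: is_diff_cst.
  by apply/funext => v; exact: ff.
split; apply: constP => // v v' /=.
- congr (- _ + _); apply/matrixP => a b; rewrite !mxE.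
  apply: eq_bigr => k _; rewrite !mxE; case: eqP => // ->.
  by rewrite Lij !mul0r.
- congr (- _); apply: eq_bigr => k _.
  have [->|kj] := eqVneq k j; first by rewrite Lij !scale0r.
  by rewrite !dfwithout// eq_sym.
Qed.

Lemma pushsum_average (R : realType) (n d : nat) (L : R -> 'M[R]_n) :
  (0 < n)%N -> (forall t, 0 <= t -> generalized_laplacian (L t)) ->
  average_integrates_input (pushsum d L).
Proof.
move=> n0 Llap; exists n%:R^-1; first by rewrite invr_gt0 ltr0n.
by move=> u x w xw; exact: avg_sol xw.
Qed.

Lemma output_error_le (R : realType) (n d : nat) (L : R -> 'M[R]_n)
    (u x : R -> 'M[R]_(n, d)) (w : R -> wstate R (fun _ : 'I_n => 1%N))
    (t p : R) (i : 'I_n) : 0 < p -> p <= weights (w t) i 0 ->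
  l1norm (output (pushsum d L) u x w i t - avg (x t)) <=
    p^-1 * l1norm (disagreement (x t) (w t)).
Proof.
move=> p0 pw; have w0 : 0 < weights (w t) i 0 by exact: lt_le_trans pw.
rewrite /l1norm big_ord1 mulr_sumr (bigD1 i)//= -[leLHS]addr0 lerD//; last first.
  by apply: sumr_ge0 => k _; apply: mulr_ge0; [rewrite invr_ge0 ltW|exact: sumr_ge0].
rewrite mulr_sumr; apply: ler_sum => j _.
have -> : (output (pushsum d L) u x w i t - avg (x t)) 0 j =
    (weights (w t) i 0)^-1 * disagreement (x t) (w t) i j.
  rewrite /output /= /disagreement; move: (avg (x t)) w0 => a w0.
  rewrite ![in LHS]mxE ![in RHS]mxE big_ord1; move: w0; rewrite !mxE => w0.
  by rewrite mulrBr mulKf// gt_eqF.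
rewrite normrM gtr0_norm ?invr_gt0// ler_wpM2r//.
by rewrite lef_pV2.
Qed.

Lemma weights_ge (R : realType) (n d : nat) (L : R -> 'M[R]_n)
    (Phi : R -> R -> 'M[R]_n) (u x : R -> 'M[R]_(n, d))
    (w : R -> wstate R (fun _ : 'I_n => 1%N)) (p : R) :
  (forall t, 0 <= t -> generalized_laplacian (L t)) -> is_flow L Phi ->
  (forall s t : R, 0 <= s -> s <= t ->
    forall i, p <= (Phi t s *m (const_mx 1 : 'cV[R]_n)) i 0) ->
  trajectory (pushsum d L) u x w -> unit_weights (x 0, w 0) ->
  forall t, 0 <= t -> forall i, p <= weights (w t) i 0.
Proof.
move=> Llap flow Phip xw w0 t t0 i.
by rewrite (weights_flow Llap flow xw w0 t0); exact: Phip.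
Qed.

Lemma opnorm_continuous (R : realType) (m n : nat) (v : R -> 'M[R]_(m, n)) :
  (forall t : R, derivable v t 1) -> continuous (fun t => opnorm (v t)).
Proof.
move=> dv t.
have cv : {for t, continuous v}.
  by apply: differentiable_continuous; apply/derivable1_diffP; exact: dv.
apply/cvgrPdist_le => e e0.
pose N : R := (m * n)%:R + 1.
have N0 : 0 < N by rewrite ltr_wpDl.
have /cvgrPdist_le/(_ _ (divr_gt0 e0 N0)) := cv.
apply: filterS => s vs.
have l1 : l1norm (v t - v s) <= e.
  apply: (@le_trans _ _ (\sum_(i < m) \sum_(j < n) (e / N))).
    apply: ler_sum => i _; apply: ler_sum => j _.
    exact: le_trans (normr_entry_le _ i j) vs.
  rewrite !sumr_const !card_ord -mulrnA -[leLHS]mulr_natr.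
  rewrite -mulrA ler_piMr ?(ltW e0)// mulrC ler_pdivrMr// mul1r mulnC.
  by rewrite lerDl.
have := opnorm_le_add_l1norm (v t) (v s).
have := opnorm_le_add_l1norm (v s) (v t).
rewrite -(l1normN (v s - v t)) opprB ler_distl; lra.
Qed.

Lemma integral_primitive (R : realType) (g : R -> R) : continuous g ->
  (forall t : R, 0 <= g t) ->
  let J t := \int[@lebesgue_measure R]_(s in `[0, t]) g s in
  [/\ forall s t : R, 0 <= s -> s <= t -> J s <= J t,
    forall t : R, 0 <= J t & forall t : R, 0 < t -> is_derive t 1 J (g t)].
Proof.
move=> cg g0 J.
have ig a b : (@lebesgue_measure R).-integrable `[a, b] (EFin \o g).
  apply: continuous_compact_integrable; first exact: segment_compact.
  exact: continuous_subspaceT.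
split.
- move=> s t s0 st; rewrite -subr_ge0 /J.
  have := @Rintegral_itvB R g (BLeft 0) (BRight t) s (ig _ _).
  rewrite !bnd_simp => /(_ s0 st) ->.
  exact: Rintegral_ge0.
- by move=> t; exact: Rintegral_ge0.
- move=> t t0.
  have tt1 : t < t + 1 by rewrite ltrDl.
  have [dJ <-] := continuous_FTC1_closed tt1 (ig _ _) t0 (cg t).
  by rewrite derive1E; exact: DeriveDef.
Qed.

Lemma powR_expRN (R : realType) (c t : R) : expR (- c) `^ t = expR (- (c * t)).
Proof.
by rewrite /powR gt_eqF ?expR_gt0// expRK mulrN mulrC.
Qed.

Lemma continuous_expRM (R : realType) (c : R) (g : R -> R) : continuous g ->
  continuous (fun s => expR (c * s) * g s).
Proof.
move=> cg s; apply: cvgM; last exact: cg.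
apply: (continuous_comp (f := *%R c)); last exact: continuous_expR.
by apply: cvgM; [exact: cvg_cst|exact: cvg_id].
Qed.

(** Turns the discounted integral into a primitive with a prefactor, so that
differences of it over consecutive intervals can be telescoped. *)
Lemma discounted_integralE (R : realType) (g : R -> R) (c t : R) : continuous g ->
  \int[@lebesgue_measure R]_(s in `[0, t]) (expR (- c) `^ (t - s) * g s) =
  expR (- (c * t)) * \int[@lebesgue_measure R]_(s in `[0, t]) (expR (c * s) * g s).
Proof.
move=> cg; rewrite -RintegralZl//.
  apply: eq_Rintegral => s _.
  by rewrite powR_expRN mulrA -expRD; congr (expR _ * _); ring.
apply: continuous_compact_integrable; first exact: segment_compact.
apply: continuous_subspaceT; exact: continuous_expRM.
Qed.

Lemma disagreement_initial_le (R : realType) (n d : nat) (L : R -> 'M[R]_n)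
    (u x : R -> 'M[R]_(n, d)) (w : R -> wstate R (fun _ : 'I_n => 1%N)) :
  (0 < n)%N -> (forall t, 0 <= t -> generalized_laplacian (L t)) ->
  trajectory (pushsum d L) u x w -> unit_weights (x 0, w 0) ->
  (forall t, 0 <= t -> forall i, 0 <= weights (w t) i 0) ->
  l1norm (disagreement (x 0) (w 0)) <= n.+1%:R * l1norm (x 0).
Proof.
move=> n0 Llap xw w0 wpos.
have := l1norm_weights_mulmx (avg (x 0)) Llap xw w0 (lexx 0) (wpos _ (lexx 0)).
have := l1norm_avg_le (x 0) n0.
rewrite -(@ler_pM2l _ n%:R) ?ltr0n//.
have := l1normD (x 0) (- (weights (w 0) *m avg (x 0))).
rewrite l1normN -/(disagreement (x 0) (w 0)) -natr1; lra.
Qed.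

(** The rate [c] is chosen so that the weight [expR (c t)] doubles over a time
[T]. In the weighted quantity [expR (c t) e(t)] the halving becomes
non-expansion, and the contributions of the input add up to increments of [J].
*)
Lemma contraction_telescope (R : realType) (e J : R -> R) (c T K : R) : 0 < T ->
  0 <= c -> expR (c * T) = 2 -> 0 <= K -> (forall t, 0 <= t -> 0 <= J t) ->
  (forall t, 0 <= t -> 0 <= e t) ->
  (forall t, 0 <= t -> t <= T -> e t <= e 0 + K * J t) ->
  (forall s, 0 <= s ->
    e (s + T) <= 2^-1 * e s + K * (expR (- (c * s)) * (J (s + T) - J s))) ->
  forall t, 0 <= t -> expR (c * t) * e t <= 2 * e 0 + 2 * K * J t.
Proof.
move=> T0 c0 cT K0 J0 e_ge0 base step t t0.
have [k tk] : exists k : nat, t <= k.+1%:R * T.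
  exists (Num.truncn (t / T)); rewrite -ler_pdivrMr//.
  by apply/ltW/truncnS_gt.
elim: k t t0 tk => [|k IHk] t t0 tk.
  have tT : t <= T by rewrite mul1r in tk.
  have E2 : expR (c * t) <= 2 by rewrite -cT ler_expR ler_wpM2l.
  apply: (@le_trans _ _ (2 * e t)); first by rewrite ler_wpM2r// e_ge0.
  by have := base t t0 tT; lra.
have [tT|Tt] := leP t T.
  apply: IHk => //; apply: (le_trans tT).
  by rewrite ler_peMl ?ler1n// ltW.
set s := t - T.
have s0 : 0 <= s by rewrite subr_ge0 ltW.
have sk : s <= k.+1%:R * T.
  by rewrite lerBlDr (le_trans tk)// -[k.+2%:R]natr1 mulrDl mul1r.
have st : t = s + T by rewrite subrK.
rewrite st mulrDr expRD cT.
have := IHk s s0 sk; have := step s s0.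
have Es : 0 < expR (c * s) by exact: expR_gt0.
rewrite -(ler_pM2l Es) => H1 H2.
have HE : expR (c * s) * expR (- (c * s)) = 1 by rewrite -expRD subrr expR0.
have : expR (c * s) * (2^-1 * e s + K * (expR (- (c * s)) * (J (s + T) - J s)))
  = 2^-1 * (expR (c * s) * e s) +
    K * (expR (c * s) * expR (- (c * s)) * (J (s + T) - J s)).
  by ring.
rewrite HE mul1r; lra.
Qed.

(** On an interval starting at [s] the input is at most [expR (- (c s))] times
the derivative of the weighted integral [J], since [expR (- (c r))] decreases
in [r]. *)
Lemma pushsum_tracks (R : realType) (n d : nat) (L : R -> 'M[R]_n)
    (Phi : R -> R -> 'M[R]_n) : (0 < n)%N -> (0 < d)%N ->
  (forall t, 0 <= t -> generalized_laplacian (L t)) -> is_flow L Phi ->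
  class_Pstar Phi -> weakly_exp_ergodic Phi ->
  outputs_track_average (pushsum d L) (@unit_weights R n d).
Proof.
move=> n0 d0 Llap flow [p p0 Phip] erg u [v [dv uv]].
have [T T0 halves] := ergodic_halves_zero_sum d n0 erg.
pose c := ln 2 / T.
have ln2 : 0 < ln 2 :> R by rewrite ln_gt0// ltr1n.
have c0 : 0 < c by rewrite divr_gt0.
have cT : expR (c * T) = 2 by rewrite mulfVK ?gt_eqF// lnK// posrE.
pose K : R := n.+1%:R * (n * d)%:R.
have K0 : 0 < K by rewrite mulr_gt0// ltr0n muln_gt0 n0.
pose ov t := opnorm (v t).
have cov : continuous ov by exact: opnorm_continuous (dv 0%N).
have ov0 t : 0 <= ov t by exact: opnorm_ge0.
pose g s := expR (c * s) * ov s.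
have cg : continuous g by exact: continuous_expRM.
have g0 t : 0 <= g t by rewrite mulr_ge0// ltW// expR_gt0.
have [Jnd J0 dJ] := integral_primitive cg g0.
set J := fun t : R => \int[lebesgue_measure]_(s in `[0, t]) g s in Jnd J0 dJ.
exists (expR (- c)), (p^-1 * (2 * K)); split.
- by rewrite ltW ?expR_gt0//= -[ltRHS]expR0 ltr_expR oppr_lt0.
- by rewrite mulr_gt0 ?invr_gt0// mulr_gt0.
move=> x w xw w0 i t t0.
have wp := weights_ge Llap flow Phip xw w0.
have wpos r : 0 <= r -> forall i, 0 <= weights (w r) i 0.
  by move=> r0 j; apply: le_trans (wp r r0 j); exact: ltW.
have -> : \int[lebesgue_measure]_(s in `[0, t]) (expR (- c) `^ (t - s) * opnorm (u s)) =
    expR (- (c * t)) * J t.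
  apply: etrans (discounted_integralE c t cov); apply: eq_Rintegral => s.
  by rewrite inE/= in_itv/= => /andP[s0 _]; rewrite uv.
rewrite powR_expRN.
pose e r := l1norm (disagreement (x r) (w r)).
have maj s : 0 <= s -> forall T', input_majorant u s T'
    (fun r => (n * d)%:R * (expR (- (c * s)) * J r))
    (fun r => (n * d)%:R * (expR (- (c * s)) * g r)).
  move=> s0 T'; split.
    move=> r r' sr rr' _; rewrite ler_wpM2l// ler_wpM2l ?expR_ge0//.
    by apply: Jnd => //; exact: le_trans sr.
  move=> r sr rT'; have r0 : 0 < r by exact: le_lt_trans sr.
  split; first by apply: is_deriveZ; apply: is_deriveZ; exact: dJ.
  rewrite uv ?(ltW r0)// (le_trans (l1norm_le_opnorm _))// ler_wpM2l//.
  rewrite /g mulrA -expRD ler_peMl ?opnorm_ge0// -[leLHS]expR0 ler_expR.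
  by rewrite addrC -mulrBr mulr_ge0 ?(ltW c0)// subr_ge0 ltW.
have He : expR (c * t) * e t <= 2 * e 0 + 2 * K * J t.
  apply: (@contraction_telescope R e J c T K) => //.
  - exact: ltW.
  - exact: ltW.
  - by move=> s _; exact: J0.
  - by move=> s _; exact: l1norm_ge0.
  - move=> s s0 _.
    have := disagreement_le n0 Llap xw w0 wpos (lexx 0) s0 (maj 0 (lexx 0) s).
    rewrite -/(e s) -/(e 0) mulr0 oppr0 expR0 !mul1r -mulrBr mulrA -/K.
    move=> /le_trans; apply; rewrite lerD2l mulrBr lerBlDr lerDl.
    by apply: mulr_ge0; [exact: ltW|exact: J0].
  - move=> s s0; have ssT : s <= s + T by rewrite ler_wpDr// ltW.
    have := disagreement_flow_le n0 Llap flow xw w0 wpos s0 ssT (maj s s0 (s + T)).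
    rewrite -/(e (s + T)) -!mulrBr mulrA -/K => H.
    apply: (le_trans H); rewrite /K -!mulrA lerD2r; apply: halves => // j.
    exact: disagreement_zero_sum xw w0 s0.
have e0K : e 0 <= K * opnorm (x 0).
  apply: (le_trans (disagreement_initial_le n0 Llap xw w0 wpos)).
  by rewrite /K -mulrA ler_wpM2l// l1norm_le_opnorm.
apply: (@le_trans _ _ (p^-1 * e t)).
  apply: le_trans (output_error_le L u x p0 (wp t t0 i)).
  by rewrite (le_trans (l2norm_le_l1norm _))// /l1norm big_ord1.
rewrite -mulrA ler_pM2l ?invr_gt0//.
have -> : e t = expR (- (c * t)) * (expR (c * t) * e t).
  by rewrite mulrA -expRD addNr expR0 mul1r.
rewrite -mulrDr [leRHS]mulrCA ler_pM2l ?expR_gt0//.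
lra.
Qed.

(** * First-order inequalities for convex functions *)

Lemma derive_gradient (R : realType) (d : nat) (f : 'rV[R]_d -> R) (z v : 'rV[R]_d) :
  differentiable f z -> 'D_v f z = \sum_j gradient f z 0 j * v 0 j.
Proof.
move=> df; rewrite deriveE// {1}(row_sum_delta v) linear_sum/=.
by apply: eq_bigr => j _; rewrite linearZ/= mxE deriveE// mulrC.
Qed.

(** The chord slopes of [f] from [z] towards [z'] are at most [f z' - f z],
and they tend to the directional derivative. *)
Lemma convex_gradient_le (R : realType) (d : nat) (f : 'rV[R]_d -> R) (z z' : 'rV[R]_d) :
  convex_function setT f -> differentiable f z ->
  f z + \sum_j gradient f z 0 j * (z' - z) 0 j <= f z'.
Proof.
move=> fconv df; rewrite -derive_gradient// -lerBrDl.
apply/ler_addgt0Pr => e e0.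
have /cvgrPdist_le/(_ _ e0) := @diff_derivable _ _ _ f z (z' - z) df.
rewrite near_withinE => dfe.
have H : \forall h \near 0^'+,
    `|'D_(z' - z) f z - h^-1 * (f (h *: (z' - z) + z) - f z)| <= e.
  rewrite near_withinE; apply: filterS dfe => h + h0.
  by rewrite gt_eqF//; exact.
have [h [[h0 h1]]] : exists h, (0 < h /\ h <= 1) /\
    `|'D_(z' - z) f z - h^-1 * (f (h *: (z' - z) + z) - f z)| <= e.
  suff : \forall h \near 0^'+, (0 < h /\ h <= 1) /\
    `|'D_(z' - z) f z - h^-1 * (f (h *: (z' - z) + z) - f z)| <= e.
    by move=> /filter_ex.
  near=> h; split; last by near: h.
  by split; near: h; [exact: nbhs_right_gt|exact: nbhs_right_le].
move=> /(le_trans (ler_norm _)).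
have /= := fconv (Itv01 (ltW h0) h1) z' z.
rewrite !inE => /(_ I I).
rewrite convRE/= => fh.
have -> : h *: (z' - z) + z = h *: z' + (1 - h) *: z.
  by rewrite scalerBr scalerBl scale1r addrA addrAC.
rewrite lerBlDr => /le_trans; apply; rewrite [leRHS]addrC lerD2l.
rewrite ler_pdivrMl//; move: fh; rewrite /unstable.onem => fh.
apply: le_trans (lerB fh (lexx (f z))) _; lra.
Unshelve. all: by end_near. Qed.

Lemma pairing_le (R : realType) (d : nat) (g v : 'rV[R]_d) (G : R) :
  (forall j, `|g 0 j| <= G) -> \sum_j g 0 j * v 0 j <= G * l1norm v.
Proof.
move=> gG; rewrite /l1norm big_ord1 mulr_sumr; apply: ler_sum => j _.
by rewrite (le_trans (ler_norm _))// normrM ler_wpM2r.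
Qed.

(** The first-order inequality at [z] bounds the difference from this side;
exchanging the points bounds it from the other. *)
Lemma convex_lipschitz (R : realType) (d : nat) (f : 'rV[R]_d -> R)
    (z z' : 'rV[R]_d) (G : R) :
  convex_function setT f -> differentiable f z ->
  (forall j, `|gradient f z 0 j| <= G) -> f z - f z' <= G * l1norm (z - z').
Proof.
move=> fconv df gG; have := convex_gradient_le z' fconv df.
have := pairing_le (z - z') gG.
have -> : \sum_j gradient f z 0 j * (z' - z) 0 j =
    - \sum_j gradient f z 0 j * (z - z') 0 j.
  by rewrite -sumrN; apply: eq_bigr => j _; rewrite -mulrN !mxE opprB.
lra.
Qed.

(** * Scalar recursions *)

(** Since [(e/2 + C a)^2 <= e^2/2 + 2 C^2 a^2], half of the sum of squares is
absorbed by the left-hand side. *)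
Lemma halving_sum_sqr (R : realType) (a e : nat -> R) (C A : R) : 0 <= C ->
  (forall k, 0 <= a k) -> (forall k, 0 <= e k) ->
  (forall k, e k.+1 <= 2^-1 * e k + C * a k) ->
  (forall N, \sum_(k < N) a k ^+ 2 <= A) ->
  forall N, \sum_(k < N) e k ^+ 2 <= 2 * (e 0%N ^+ 2 + 2 * C ^+ 2 * A).
Proof.
move=> C0 a0 e0 estep aA N.
have esq k : e k.+1 ^+ 2 <= 2^-1 * e k ^+ 2 + 2 * C ^+ 2 * a k ^+ 2.
  have rhs0 : 0 <= 2^-1 * e k + C * a k.
    by rewrite addr_ge0// mulr_ge0// invr_ge0.
  have H : e k.+1 ^+ 2 <= (2^-1 * e k + C * a k) ^+ 2.
    by rewrite ler_pXn2r ?nnegrE.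
  apply: (le_trans H).
  have : 0 <= (2^-1 * e k - C * a k) ^+ 2 by exact: sqr_ge0.
  by nra.
have H1 : \sum_(k < N) e k.+1 ^+ 2 <=
    2^-1 * (\sum_(k < N) e k ^+ 2) + 2 * C ^+ 2 * A.
  apply: le_trans (ler_sum _ (fun (k : 'I_N) _ => esq k)) _.
  rewrite big_split/= -!mulr_sumr lerD2l.
  by apply: ler_wpM2l; [rewrite mulr_ge0// sqr_ge0|exact: aA].
have H2 : \sum_(k < N) e k ^+ 2 <= \sum_(k < N.+1) e k ^+ 2.
  by rewrite big_ord_recr/= lerDl sqr_ge0.
rewrite big_ord_recl/= in H2.
have H3 : \sum_(i < N) e (bump 0 i) ^+ 2 = \sum_(k < N) e k.+1 ^+ 2 by [].
rewrite H3 in H2.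
lra.
Qed.

Lemma bounded_sums_tail (R : realType) (b : nat -> R) (B delta : R) :
  (forall k, 0 <= b k) -> (forall N, \sum_(k < N) b k <= B) -> 0 < delta ->
  exists N, forall k m, (N <= k)%N -> \sum_(k <= j < k + m) b j <= delta.
Proof.
move=> b0 bB d0.
pose S := [set \sum_(k < N) b k | N in [set: nat]].
have supS : has_sup S.
  by split; [exists (\sum_(k < 0) b k); exists 0%N|exists B => _ [N _ <-]].
have [_ [N _ <-] HN] := sup_adherent d0 supS.
exists N => k m Nk.
have split_sum i j : (i <= j)%N ->
    \sum_(l < j) b l = \sum_(l < i) b l + \sum_(i <= l < j) b l.
  by move=> ij; rewrite -!(big_mkord xpredT) -big_cat_nat.
have H1 := split_sum N k Nk; have H2 := split_sum k (k + m)%N (leq_addr _ _).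
have H3 : \sum_(l < k + m) b l <= sup S.
  by apply: sup_upper_bound => //; exists (k + m)%N.
have H4 : 0 <= \sum_(N <= l < k) b l by apply: sumr_ge0.
lra.
Qed.

(** Summing the recursion bounds the sum of [a k * g k]; if [g] stayed above
[eta] from [N] on, the sum of [a] would be bounded too. *)
Lemma divergent_weights_small (R : realType) (a g b V : nat -> R) (c B eta : R)
    (N : nat) :
  0 < c -> (forall k, 0 <= a k) -> (forall k, 0 <= g k) -> (forall k, 0 <= V k) ->
  (forall k, V k.+1 <= V k - c * (a k * g k) + b k) ->
  (forall N, \sum_(k < N) b k <= B) ->
  (forall M, exists N, M < \sum_(k < N) a k) -> 0 < eta ->
  exists2 k, (N <= k)%N & g k < eta.
Proof.
move=> c0 a0 g0 V0 step bB adiv eta0.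
apply/not_exists2P => H.
have geta k : (N <= k)%N -> eta <= g k.
  by move=> Nk; have [//|/negP] := H k; rewrite -leNgt.
have sums M : V M + c * \sum_(k < M) a k * g k <= V 0%N + \sum_(k < M) b k.
  elim: M => [|M IH]; first by rewrite !big_ord0 mulr0.
  by rewrite !big_ord_recr/= mulrDr; have := step M; lra.
have [M] := adiv (\sum_(k < N) a k + (V 0%N + B) / (c * eta)).
have ce0 : 0 < c * eta by rewrite mulr_gt0.
have [NM|MN] := leqP N M; last first.
  rewrite ltNge => /negP; apply.
  rewrite -(subnKC (ltnW MN)) -[in X in _ <= X + _](big_mkord xpredT).
  rewrite (big_cat_nat (n := M))//=; last exact: leq_addr.
  rewrite big_mkord -addrA lerDl addr_ge0 ?sumr_ge0//.
  rewrite divr_ge0 ?(ltW ce0)// addr_ge0// (le_trans _ (bB 0%N))//.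
  by rewrite big_ord0.
rewrite -[in X in _ < X](big_mkord xpredT) (big_cat_nat (n := N))//= big_mkord ltrD2l.
rewrite ltr_pdivrMr// ltNge => /negP; apply.
have HM := sums M; rewrite -(big_mkord xpredT (fun k => a k * g k)) in HM.
rewrite (big_cat_nat (n := N))//= in HM.
have H1 : 0 <= \sum_(0 <= k < N) a k * g k.
  by apply: sumr_ge0 => k _; rewrite mulr_ge0.
have H2 : (\sum_(N <= k < M) a k) * eta <= \sum_(N <= k < M) a k * g k.
  rewrite mulr_suml !big_nat; apply: ler_sum => k /andP[Nk _].
  by rewrite ler_wpM2l// geta.
have {H1 H2} H3 : (\sum_(N <= k < M) a k) * eta <=
    \sum_(0 <= k < N) a k * g k + \sum_(N <= k < M) a k * g k by lra.
rewrite mulrCA; rewrite -(ler_pM2l c0) in H3.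
have := bB M; have := V0 M; lra.
Qed.

(** * Integrals of monotone functions on the half-line *)

Lemma halfline_partition (R : realType) (T : R) : 0 < T ->
  `[0, +oo[%classic = \bigcup_k `[k%:R * T, k.+1%:R * T[%classic /\
  trivIset [set: nat] (fun k : nat => `[k%:R * T, k.+1%:R * T[%classic).
Proof.
move=> T0; split.
  apply/seteqP; split=> t /=.
    rewrite in_itv/= andbT => t0.
    exists (Num.truncn (t / T)) => //=; rewrite in_itv/=.
    have /Num.Theory.truncn_itv : 0 <= t / T by rewrite divr_ge0// ltW.
    by rewrite ler_pdivlMr// ltr_pdivrMr.
  move=> [k _ /=]; rewrite !in_itv/= andbT => /andP[kt _].
  by apply: le_trans kt; rewrite mulr_ge0// ltW.
apply: ltn_trivIset => i j ij; rewrite -subset0 => t /=.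
rewrite !in_itv/= => -[/andP[_ tj] /andP[it _]].
have jiT : j.+1%:R * T <= i%:R * T by rewrite ler_pM2r// ler_nat.
by have := lt_le_trans tj (le_trans jiT it); rewrite ltxx.
Qed.

Lemma nonincreasing_halfline_measurable (R : realType) (f : R -> R) :
  (forall s t : R, 0 <= s -> s <= t -> f t <= f s) ->
  measurable_fun (`[0, +oo[%classic : set (measurableTypeR R))
    (f : measurableTypeR R -> measurableTypeR R).
Proof.
move=> fni.
apply: (eq_measurable_fun (fun t : measurableTypeR R => f (Num.max 0 t))).
  by move=> t; rewrite inE/= in_itv/= andbT => t0; rewrite max_r.
apply: nonincreasing_measurable => // s t st; apply: fni.
  by rewrite le_max lexx.
by rewrite ge_max le_max lexx/= le_max st orbT.
Qed.

Lemma integral_step (R : realType) (f : R -> R) (T : R) (k : nat) : 0 < T ->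
  (forall s t : R, 0 <= s -> s <= t -> f t <= f s) ->
  (forall t, 0 <= t -> 0 <= f t) ->
  ((T * f (k.+1%:R * T))%:E <=
   \int[@lebesgue_measure R]_(t in `[(k%:R * T)%R, (k.+1%:R * T)%R[) (f t)%:E <=
   (T * f (k%:R * T))%:E)%E.
Proof.
move=> T0 fni f0.
have kT : k%:R * T < k.+1%:R * T by rewrite ltr_pM2r// ltr_nat.
have kT0 : 0 <= k%:R * T by rewrite mulr_ge0// ltW.
have mf : measurable_fun `[k%:R * T, k.+1%:R * T[ (EFin \o f).
  apply/measurable_EFinP.
  apply: measurable_funS (nonincreasing_halfline_measurable fni) => //.
  move=> t /=; rewrite !in_itv/= andbT => /andP[kt _]; exact: le_trans kt.
have cstE r : (T * r)%:E =
    (\int[@lebesgue_measure R]_(t in `[(k%:R * T)%R, (k.+1%:R * T)%R[) cst r%:E t)%E.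
  rewrite integral_cst//= [X in (_ * X)%E]lebesgue_measure_itv/= lte_fin kT.
  by rewrite -EFinB -EFinM -mulrBl -natrB// subSnn mul1r mulrC.
rewrite !cstE; apply/andP; split; apply: ge0_le_integral => //.
- by move=> t _; rewrite lee_fin f0// ltW// (le_lt_trans kT0).
- move=> t /=; rewrite in_itv/= => /andP[kt tk]; rewrite lee_fin.
  by apply: fni; [exact: le_trans kt|exact: ltW].
- move=> t /=; rewrite in_itv/= => /andP[kt tk]; rewrite lee_fin.
  by apply: f0; exact: le_trans kt.
- move=> t /=; rewrite in_itv/= => /andP[kt tk]; rewrite lee_fin.
  exact: fni.
Qed.

Lemma integral_halfline_series (R : realType) (f : R -> R) (T : R) : 0 < T ->
  (forall s t : R, 0 <= s -> s <= t -> f t <= f s) ->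
  (forall t, 0 <= t -> 0 <= f t) ->
  (\int[@lebesgue_measure R]_(t in `[0%R, +oo[) (f t)%:E =
   \sum_(0 <= k <oo)
     \int[@lebesgue_measure R]_(t in `[(k%:R * T)%R, (k.+1%:R * T)%R[) (f t)%:E)%E.
Proof.
move=> T0 fni f0; have [E tI] := halfline_partition T0.
rewrite [in LHS]E ge0_integral_bigcup//.
- rewrite -E; apply/measurable_EFinP.
  exact: nonincreasing_halfline_measurable.
- by move=> t; rewrite -E/= in_itv/= andbT lee_fin => /f0.
Qed.

Lemma integral_infinite_sums (R : realType) (f : R -> R) (T : R) : 0 < T ->
  (forall s t : R, 0 <= s -> s <= t -> f t <= f s) ->
  (forall t, 0 <= t -> 0 <= f t) ->
  (\int[@lebesgue_measure R]_(t in `[0%R, +oo[) (f t)%:E = +oo)%E ->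
  forall M, exists N, M < \sum_(k < N) f (k%:R * T).
Proof.
move=> T0 fni f0 foo M; apply/not_existsP => H.
move: foo; rewrite (integral_halfline_series T0 fni f0).
have step k := integral_step k T0 fni f0.
have step0 k : (0 <=
    \int[@lebesgue_measure R]_(t in `[(k%:R * T)%R, (k.+1%:R * T)%R[) (f t)%:E)%E.
  have /andP[+ _] := step k; apply: le_trans.
  by rewrite lee_fin mulr_ge0 ?(ltW T0)// f0// mulr_ge0// ltW.
apply/eqP; rewrite lt_eqF//; apply: (@le_lt_trans _ _ (T * M)%:E); last exact: ltry.
apply: lime_le; first by apply: is_cvg_nneseries => k _ _; exact: step0.
near=> N.
apply: (@le_trans _ _ (\sum_(0 <= k < N) (T * f (k%:R * T))%:E)%E).
  by apply: lee_sum => k _; have /andP[] := step k.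
rewrite sumEFin lee_fin -mulr_sumr ler_pM2l// big_mkord.
by rewrite leNgt; apply/negP; exact: H.
Unshelve. all: by end_near. Qed.

Lemma integral_finite_sums (R : realType) (f : R -> R) (T : R) : 0 < T ->
  (forall s t : R, 0 <= s -> s <= t -> f t <= f s) ->
  (forall t, 0 <= t -> 0 <= f t) ->
  (\int[@lebesgue_measure R]_(t in `[0%R, +oo[) (f t)%:E < +oo)%E ->
  exists A, forall N, \sum_(k < N) f (k%:R * T) <= A.
Proof.
move=> T0 fni f0.
rewrite (integral_halfline_series T0 fni f0).
have step k := integral_step k T0 fni f0.
have step0 k : (0 <=
    \int[@lebesgue_measure R]_(t in `[(k%:R * T)%R, (k.+1%:R * T)%R[) (f t)%:E)%E.
  have /andP[+ _] := step k; apply: le_trans.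
  by rewrite lee_fin mulr_ge0 ?(ltW T0)// f0// mulr_ge0// ltW.
set S := (X in (X < _)%E) => Soo.
have S0 : (0 <= S)%E by apply: nneseries_ge0 => k _ _; exact: step0.
have Sfin : S \is a fin_num by rewrite ge0_fin_numE.
exists (f 0 + T^-1 * fine S) => -[|N].
  by rewrite big_ord0 addr_ge0 ?f0// mulr_ge0 ?invr_ge0 ?(ltW T0)// fine_ge0.
rewrite big_ord_recl/= mul0r lerD2l ler_pdivlMl// mulr_sumr.
rewrite -lee_fin fineK//; apply: le_trans (nneseries_lim_ge N _); last first.
  by move=> k _ _; exact: step0.
rewrite big_mkord -sumEFin; apply: lee_sum => k _.
by have /andP[] := step k.
Qed.

(** * One sampling step of the gradient feedback *)

Definition sqdist (R : realType) (d : nat) (y z : 'rV[R]_d) : R :=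
  \sum_j (y - z) 0 j ^+ 2.

Lemma feedback_input_le (R : realType) (n d : nat) (f : 'I_n -> 'rV[R]_d -> R)
    (u : 'M[R]_(n, d)) (y : 'I_n -> 'rV[R]_d) (a G : R) : 0 <= a ->
  (forall i z j, `|gradient (f i) z 0 j| <= G) ->
  (forall i, row i u = - a *: gradient (f i) (y i)) ->
  l1norm u <= a * ((n * d)%:R * G).
Proof.
move=> a0 fG uE.
have -> : a * ((n * d)%:R * G) = \sum_(i < n) \sum_(j < d) a * G.
  by rewrite !sumr_const !card_ord -mulrnA -[in RHS]mulr_natl mulnC; ring.
apply: ler_sum => i _; apply: ler_sum => j _.
have -> : u i j = - a * gradient (f i) (y i) 0 j.
  by have /matrixP/(_ 0 j) := uE i; rewrite !mxE.
by rewrite normrM normrN (ger0_norm a0) ler_wpM2l.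
Qed.

Lemma feedback_majorant (R : realType) (n d : nat)
    (f : 'I_n -> 'rV[R]_d -> R) (u : R -> 'M[R]_(n, d))
    (y : 'I_n -> R -> 'rV[R]_d) (alpha : R -> R) (G s T : R) : 0 <= G ->
  (forall i z j, `|gradient (f i) z 0 j| <= G) ->
  (forall t, 0 <= t -> 0 < alpha t) ->
  (forall s t, 0 <= s -> s <= t -> alpha t <= alpha s) ->
  (forall t i, 0 <= t -> row i (u t) = - alpha t *: gradient (f i) (y i t)) ->
  0 <= s ->
  input_majorant u s T (fun r => alpha s * ((n * d)%:R * G) * r)
    (fun=> alpha s * ((n * d)%:R * G)).
Proof.
move=> G0 fG alpha0 alphani uE s0.
have aH0 : 0 <= alpha s * ((n * d)%:R * G).
  by rewrite mulr_ge0 ?(ltW (alpha0 _ s0))// mulr_ge0.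
split=> [r1 r2 _ r12 _|r sr _]; first by rewrite ler_wpM2l.
split.
  have := is_deriveZ (alpha s * ((n * d)%:R * G)) (is_derive_id r (1 : R)).
  by rewrite /GRing.scale/= mulr1.
have r0 : 0 <= r by rewrite (le_trans s0)// ltW.
apply: le_trans (feedback_input_le (ltW (alpha0 _ r0)) fG (fun i => uE r i r0)) _.
by rewrite ler_wpM2r ?mulr_ge0// alphani// ltW.
Qed.

(** Convexity is used at the outputs [y_i], where the gradients are taken;
moving from [y_i] to the common point [q] costs [G rho] twice, once in the
pairing and once in the value of [f i]. *)
Lemma feedback_pairing_le (R : realType) (n d : nat) (f : 'I_n -> 'rV[R]_d -> R)
    (u : 'M[R]_(n, d)) (y : 'I_n -> 'rV[R]_d) (q z : 'rV[R]_d) (a G rho : R) :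
  (0 < n)%N -> 0 <= a -> 0 <= G ->
  (forall i, convex_function setT (f i)) ->
  (forall i z, differentiable (f i) z) ->
  (forall i z j, `|gradient (f i) z 0 j| <= G) ->
  (forall i, row i u = - a *: gradient (f i) (y i)) ->
  (forall i, l1norm (y i - q) <= rho) ->
  \sum_j (q - z) 0 j * avg u 0 j <=
    - (n%:R^-1 * a * (\sum_i f i q - \sum_i f i z)) + 2 * G * a * rho.
Proof.
move=> n0 a0 G0 fconv fdiff fG uE yq.
have nn0 : 0 < n%:R :> R by rewrite ltr0n.
have -> : \sum_j (q - z) 0 j * avg u 0 j =
    - (n%:R^-1 * a * \sum_i \sum_j gradient (f i) (y i) 0 j * (q - z) 0 j).
  rewrite exchange_big/= mulr_sumr -sumrN; apply: eq_bigr => j _.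
  rewrite avgE -mulr_suml.
  have -> : \sum_i u i j = - a * \sum_i gradient (f i) (y i) 0 j.
    rewrite mulr_sumr; apply: eq_bigr => i _.
    by have /matrixP/(_ 0 j) := uE i; rewrite !mxE.
  move: ((q - z) 0 j) (\sum_i _) => A B; ring.
have H i : f i q - f i z - 2 * G * rho <=
    \sum_j gradient (f i) (y i) 0 j * (q - z) 0 j.
  have H1 := convex_gradient_le z (fconv i) (fdiff i (y i)).
  have H2 := pairing_le (y i - q) (fG i (y i)).
  have H3 : f i q - f i (y i) <= G * l1norm (q - y i).
    exact: convex_lipschitz (fconv i) (fdiff i q) (fG i q).
  rewrite -(l1normN (q - y i)) opprB in H3.
  have H4 : G * l1norm (y i - q) <= G * rho by rewrite ler_wpM2l.
  have -> : \sum_j gradient (f i) (y i) 0 j * (q - z) 0 j =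
      - (\sum_j gradient (f i) (y i) 0 j * (z - y i) 0 j)
      - \sum_j gradient (f i) (y i) 0 j * (y i - q) 0 j.
    rewrite -sumrN -sumrB; apply: eq_bigr => j _.
    by move: (gradient (f i) (y i)) => g; rewrite !mxE; ring.
  lra.
have Hs : \sum_i f i q - \sum_i f i z - 2 * G * rho * n%:R <=
    \sum_i \sum_j gradient (f i) (y i) 0 j * (q - z) 0 j.
  have -> : 2 * G * rho * n%:R = \sum_(i < n) 2 * G * rho.
    by rewrite sumr_const card_ord mulr_natr.
  by rewrite -!sumrB; apply: ler_sum.
have na0 : 0 <= n%:R^-1 * a by rewrite mulr_ge0// invr_ge0.
have := ler_wpM2l na0 Hs.
have -> : n%:R^-1 * a * (\sum_i f i q - \sum_i f i z - 2 * G * rho * n%:R) =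
    n%:R^-1 * a * (\sum_i f i q - \sum_i f i z) - 2 * G * a * rho.
  by field; rewrite gt_eqF.
lra.
Qed.

Lemma sum_sqr_le_l1norm (R : realType) (d : nat) (v : 'rV[R]_d) (c : R) :
  l1norm v <= c -> \sum_j v 0 j ^+ 2 <= c ^+ 2.
Proof.
move=> vc; have v0 := l1norm_ge0 v.
apply: (@le_trans _ _ (l1norm v ^+ 2)); last first.
  by rewrite ler_pXn2r ?nnegrE// (le_trans v0).
rewrite expr2 {1}/l1norm big_ord1 mulr_suml; apply: ler_sum => j _.
rewrite -real_normK ?num_real// expr2 ler_wpM2l//.
exact: l1norm_entry_le.
Qed.

(** The square of the distance is expanded around time [s], which leaves the
linear functional [<avg (x s) - z, avg (x t)>], to which the comparison lemma
applies, and the square of the displacement of the average, of order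
[alpha(s)^2]. *)
Lemma sqdist_descent (R : realType) (n d : nat) (L : R -> 'M[R]_n)
    (u x : R -> 'M[R]_(n, d)) (w : R -> wstate R (fun _ : 'I_n => 1%N))
    (f : 'I_n -> 'rV[R]_d -> R) (alpha : R -> R) (p G H s t T : R) (z : 'rV[R]_d) :
  (0 < n)%N -> (forall t, 0 <= t -> generalized_laplacian (L t)) ->
  trajectory (pushsum d L) u x w -> unit_weights (x 0, w 0) -> 0 < p ->
  (forall t, 0 <= t -> forall i, p <= weights (w t) i 0) ->
  (forall i, convex_function setT (f i)) ->
  (forall i z, differentiable (f i) z) -> 0 <= G ->
  (forall i z j, `|gradient (f i) z 0 j| <= G) ->
  H = (n * d)%:R * G ->
  (forall t, 0 <= t -> 0 < alpha t) ->
  (forall s t, 0 <= s -> s <= t -> alpha t <= alpha s) ->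
  (forall t i, 0 <= t -> row i (u t) =
    - alpha t *: gradient (f i) (output (pushsum d L) u x w i t)) ->
  argmin_sum f z -> 0 <= s -> s <= t -> t <= s + T ->
  sqdist (avg (x t)) z <= sqdist (avg (x s)) z
    - 2 * (t - s) * (n%:R^-1 * alpha t * (\sum_i f i (avg (x s)) - \sum_i f i z))
    + (4 * G * T * alpha s * (p^-1 * (l1norm (disagreement (x s) (w s))
         + n.+1%:R * (alpha s * H * T)) + alpha s * H * T)
       + (alpha s * H * T) ^+ 2).
Proof.
move=> n0 Llap xw w0 p0 wp fconv fdiff G0 fG HE alpha0 alphani uE zmin s0 st tT.
set e := l1norm _; set a := alpha s.
have a0 : 0 <= a by exact/ltW/alpha0.
have H0 : 0 <= H by rewrite HE mulr_ge0.
have T0 : 0 <= T by lra.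
have wpos r : 0 <= r -> forall i, 0 <= weights (w r) i 0.
  by move=> r0 j; apply: le_trans (wp r r0 j); exact: ltW.
have aH0 : 0 <= a * H by exact: mulr_ge0.
have maj r : input_majorant u s r (fun r => a * H * r) (fun=> a * H).
  by rewrite /a HE; exact: (feedback_majorant _ G0 fG alpha0 alphani uE s0).
have xinc r : s <= r -> r <= s + T ->
    l1norm (avg (x r) - avg (x s)) <= a * H * T.
  move=> sr rT; apply: le_trans (avg_increment_le n0 Llap xw s0 sr (maj r)) _.
  by rewrite -mulrBr ler_wpM2l// lerBlDl.
set rho := p^-1 * (e + n.+1%:R * (a * H * T)) + a * H * T.
have yrho r i : s <= r -> r <= s + T ->
    l1norm (output (pushsum d L) u x w i r - avg (x s)) <= rho.
  move=> sr rT; have r0 : 0 <= r by exact: le_trans sr.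
  rewrite -(subrK (avg (x r)) (output _ _ _ _ _ _)) -addrA.
  apply: (le_trans (l1normD _ _)); apply: lerD; last exact: xinc.
  apply: (le_trans (output_error_le L u x p0 (wp r r0 i))).
  rewrite ler_pM2l ?invr_gt0//.
  apply: le_trans (disagreement_le n0 Llap xw w0 wpos s0 sr (maj r)) _.
  by rewrite lerD2l ler_wpM2l// -mulrBr ler_wpM2l// lerBlDl.
pose q := avg (x s).
have g0 : 0 <= \sum_i f i q - \sum_i f i z by rewrite subr_ge0; exact: zmin.
set g := \sum_i f i q - _ in g0.
have rho0 : 0 <= rho.
  have e0 : 0 <= e by exact: l1norm_ge0.
  have aHT : 0 <= a * H * T by exact: mulr_ge0.
  by rewrite addr_ge0// mulr_ge0 ?invr_ge0 ?(ltW p0)// addr_ge0// mulr_ge0.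
have phisol : caratheodory_sol s (fun r => \sum_j (q - z) 0 j *: avg (x r) 0 j)
    (fun r => \sum_j (q - z) 0 j *: avg (u r) 0 j).
  apply: caratheodory_sol_sum => j; apply: caratheodory_solZ.
  apply: caratheodory_sol_entry.
  exact: caratheodory_sol_shift s0 (avg_sol Llap xw).
have Hphi : \sum_j (q - z) 0 j *: avg (x t) 0 j - \sum_j (q - z) 0 j *: avg (x s) 0 j
    <= (- (n%:R^-1 * alpha t * g) + 2 * G * a * rho) * (t - s).
  apply: (caratheodory_sol_le st phisol) => r sr rt.
  have r0 : 0 <= r by rewrite (le_trans s0)// ltW.
  have ysr i : l1norm (output (pushsum d L) u x w i r - q) <= rho.
    by apply: yrho; [exact: ltW|exact: le_trans (ltW rt) tT].
  have := feedback_pairing_le z n0 (ltW (alpha0 r r0)) G0 fconv fdiff fG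
    (fun i => uE r i r0) ysr.
  rewrite -/g => /le_trans; apply; apply: lerD.
    rewrite lerN2 ler_wpM2r// ler_wpM2l ?invr_ge0// alphani// ltW//.
  rewrite ler_wpM2r// ler_wpM2l ?mulr_ge0// alphani// ltW//.
have -> : sqdist (avg (x t)) z = sqdist (avg (x s)) z
    + 2 * (\sum_j (q - z) 0 j *: avg (x t) 0 j - \sum_j (q - z) 0 j *: avg (x s) 0 j)
    + \sum_j (avg (x t) - avg (x s)) 0 j ^+ 2.
  rewrite /sqdist -sumrB mulr_sumr -!big_split/=; apply: eq_bigr => j _.
  rewrite /q; move: (avg (x t)) (avg (x s)) => a1 a2; rewrite !mxE /GRing.scale/=; ring.
have := sum_sqr_le_l1norm (xinc t st tT).
have : 2 * G * a * rho * (t - s) <= 2 * G * a * rho * T.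
  by rewrite ler_wpM2l ?mulr_ge0// lerBlDl.
rewrite -/q -/g; lra.
Qed.

(** * Convergence of quasi-Fejer monotone sequences *)

Lemma mx_normr_le (R : realType) (m n : nat) (A : 'M[R]_(m, n)) (c : R) :
  0 <= c -> (forall i j, `|A i j| <= c) -> `|A| <= c.
Proof.
by move=> c0 Ac; rewrite [leLHS]/Num.Def.normr/= mx_normrE bigmax_le.
Qed.

Lemma l1norm_le_normr (R : realType) (d : nat) (v : 'rV[R]_d) :
  l1norm v <= d%:R * `|v|.
Proof.
rewrite /l1norm big_ord1.
apply: (@le_trans _ _ (\sum_(j < d) `|v|)).
  by apply: ler_sum => j _; exact: normr_entry_le.
by rewrite sumr_const card_ord mulr_natl.
Qed.

(** The Bolzano-Weierstrass theorem, in the form used to extract a limit point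
of the averages. *)
Lemma bounded_sequence_cluster (R : realType) (d : nat) (xi : nat -> 'rV[R]_d)
    (M : R) : (forall k, `|xi k| <= M) ->
  exists z : 'rV[R]_d, forall (delta : R) (N : nat), 0 < delta ->
    exists2 k, (N <= k)%N & `|z - xi k| < delta.
Proof.
move=> xiM.
have cA : compact [set v : 'rV[R]_d | `|v| <= M].
  apply: bounded_closed_compact.
    exists M; split; first exact: num_real.
    by move=> r Mr v /= /le_trans; apply; exact: ltW.
  apply: (@closed_comp _ _ (fun v : 'rV[R]_d => `|v|) [set r : R | r <= M]).
    by move=> v _; exact: norm_continuous.
  exact: closed_le.
have [|z [_ zcl]] := cA (xi @ \oo) _.
  by exists 0%N => // k _; exact: xiM.
exists z => delta N d0.
have [|_ [[k Nk <-] zk]] := zcl [set xi k | k in [set k | (N <= k)%N]]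
    (ball z delta) _ (nbhsx_ballx _ _ d0).
  by exists N => // k Nk; exists k.
by exists k => //; move: zk; rewrite -ball_normE.
Qed.

Lemma sqdist_ge0 (R : realType) (d : nat) (y z : 'rV[R]_d) : 0 <= sqdist y z.
Proof. by apply: sumr_ge0 => j _; rewrite sqr_ge0. Qed.

(** The recursion with any minimiser shows that [xi] is bounded and that [F]
approaches its minimum along a subsequence. A cluster point of that
subsequence is a minimiser by continuity; the recursion at that very point
says that, once close to it, the sequence leaves by at most the tail of [b].
*)
Lemma quasi_fejer_converges (R : realType) (d : nat) (F : 'rV[R]_d -> R)
    (xi : nat -> 'rV[R]_d) (a b : nat -> R) (c B K : R) : 0 < c ->
  0 <= K -> (forall z z', F z - F z' <= K * l1norm (z - z')) ->
  (exists z, forall z', F z <= F z') ->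
  (forall k, 0 <= a k) -> (forall k, 0 <= b k) ->
  (forall M, exists N, M < \sum_(k < N) a k) ->
  (forall N, \sum_(k < N) b k <= B) ->
  (forall z, (forall z', F z <= F z') -> forall k,
    sqdist (xi k.+1) z <=
      sqdist (xi k) z - c * (a k * (F (xi k) - F z)) + b k) ->
  exists2 z, (forall z', F z <= F z') &
    forall e, 0 < e -> exists N, forall k, (N <= k)%N -> sqdist (xi k) z <= e.
Proof.
move=> c0 K0 Flip [z0 z0min] a0 b0 adiv bB step.
have fejer z k m : (forall z', F z <= F z') ->
    sqdist (xi (k + m)%N) z <= sqdist (xi k) z + \sum_(k <= j < k + m) b j.
  move=> zmin; elim: m => [|m IH]; first by rewrite addn0 big_geq// addr0.
  rewrite addnS big_nat_recr/= ?leq_addr//.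
  have H0 : 0 <= c * (a (k + m)%N * (F (xi (k + m)%N) - F z)).
    by rewrite mulr_ge0 ?(ltW c0)// mulr_ge0// subr_ge0.
  have := step z zmin (k + m)%N; lra.
have g0 k : 0 <= F (xi k) - F z0 by rewrite subr_ge0.
have /choice[kap kapP] : forall m : nat, exists k,
    (m <= k)%N /\ F (xi k) - F z0 < m.+1%:R^-1.
  move=> m.
  have [|k mk gk] := divergent_weights_small (V := fun k => sqdist (xi k) z0)
    (eta := m.+1%:R^-1) m c0 a0 g0 (fun k => sqdist_ge0 _ _)
    (step z0 z0min) bB adiv; first by rewrite invr_gt0.
  by exists k.
pose W := sqdist (xi 0%N) z0 + B.
have [|z zcl] := @bounded_sequence_cluster R d (xi \o kap) (`|z0| + (W + 1)).
  move=> m /=; rewrite -(subrKC z0 (xi _)).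
  have B0 : 0 <= B by rewrite (le_trans _ (bB 0%N))// big_ord0.
  have W0 : 0 <= W by apply: addr_ge0 => //; exact: sqdist_ge0.
  rewrite (le_trans (ler_normD _ _))// lerD2l.
  apply: mx_normr_le; first by rewrite addr_ge0.
  move=> i j; rewrite ord1 -(@ler_pXn2r _ 2)// ?nnegrE ?addr_ge0 ?sqdist_ge0//.
  rewrite real_normK ?num_real//.
  apply: (@le_trans _ _ (sqdist (xi (kap m)) z0)).
    by rewrite /sqdist (bigD1 j)//= lerDl sumr_ge0// => l _; rewrite sqr_ge0.
  apply: (@le_trans _ _ W).
    have := fejer z0 0%N (kap m) z0min; rewrite add0n big_mkord.
    have := bB (kap m); rewrite /W; lra.
  by nra.
have small delta : 0 < delta -> forall N, exists k, [/\ (N <= k)%N,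
    F (xi k) - F z0 <= delta & l1norm (z - xi k) <= d%:R * delta].
  move=> d0 N.
  (* Beyond this index the tolerance [m.+1%:R^-1] is below [delta]. *)
  pose N' := maxn N (Num.truncn delta^-1).
  have [m N'm zm] := zcl delta N' d0.
  have [mk gk] := kapP m.
  have [Nm tm] : (N <= m)%N /\ (Num.truncn delta^-1 <= m)%N.
    by apply/andP; rewrite -geq_max.
  exists (kap m); split; first exact: leq_trans mk.
    apply: (le_trans (ltW gk)).
    rewrite invf_ple ?posrE//.
    apply: (@le_trans _ _ (Num.truncn delta^-1).+1%:R).
      exact/ltW/Num.Theory.truncnS_gt.
    by rewrite ler_nat.
  apply: (le_trans (l1norm_le_normr _)); rewrite ler_wpM2l//.
  exact: ltW.
have zmin z' : F z <= F z'.
  apply: le_trans (z0min z'); apply/ler_addgt0Pr => e e0.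
  pose D := K * d%:R + 1.
  have D0 : 0 < D by rewrite ltr_wpDl// mulr_ge0.
  have [k [_ gk zk]] := small (e / D) (divr_gt0 e0 D0) 0%N.
  have := Flip z (xi k); have := ler_wpM2l K0 zk.
  have : K * (d%:R * (e / D)) + e / D = e.
    have eD : e / D * D = e by rewrite mulfVK// gt_eqF.
    by rewrite -[RHS]eD; move: (e / D) => y; rewrite /D; ring.
  lra.
exists z => // e e0.
have e20 : 0 < e / 2 by rewrite divr_gt0.
have [N HN] := bounded_sums_tail b0 bB e20.
pose delta := Num.min 1 (e / 2) / (d%:R + 1).
have d10 : 0 < d%:R + 1 :> R by rewrite ltr_wpDl.
have m0 : 0 < Num.min 1 (e / 2) by rewrite lt_min ltr01.
have [k [Nk _ zk]] := small delta (divr_gt0 m0 d10) N.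
exists k => k' kk'; rewrite -(subnKC kk').
apply: (le_trans (fejer z k (k' - k)%N zmin)).
have := HN k (k' - k)%N Nk.
suff : sqdist (xi k) z <= e / 2 by lra.
rewrite /sqdist; apply: (@le_trans _ _ (Num.min 1 (e / 2) ^+ 2)).
  apply: sum_sqr_le_l1norm; rewrite -l1normN opprB (le_trans zk)//.
  rewrite /delta mulrCA ler_piMr ?(ltW m0)// ler_pdivrMr// mul1r lerDl.
  exact: ler01.
have : Num.min 1 (e / 2) <= 1 by rewrite ge_min lexx.
have : Num.min 1 (e / 2) <= e / 2 by rewrite ge_min lexx orbT.
move: (Num.min _ _) m0 => M M0 Me M1.
by rewrite expr2 (le_trans _ Me)// ler_piMr// ltW.
Qed.

(** * Convergence of the outputs *)

Lemma le_of_sqr_le (R : realType) (a e : R) : 0 <= e -> a ^+ 2 <= e ^+ 2 ->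
  a <= e.
Proof.
move=> e0 ae; have [a0|/ltW a0] := leP 0 a; last exact: le_trans e0.
by rewrite -(@ler_pXn2r _ 2)// nnegrE.
Qed.

Lemma pushsum_descent_converges (R : realType) (n d : nat) (L : R -> 'M[R]_n)
    (Phi : R -> R -> 'M[R]_n) (f : 'I_n -> 'rV[R]_d -> R) (alpha : R -> R)
    (u x : R -> 'M[R]_(n, d)) (w : R -> wstate R (fun _ : 'I_n => 1%N)) :
  (0 < n)%N ->
  (forall t : R, 0 <= t -> generalized_laplacian (L t)) ->
  is_flow L Phi -> class_Pstar Phi -> weakly_exp_ergodic Phi ->
  (forall i, convex_function setT (f i)) ->
  (forall i z, differentiable (f i) z) ->
  (forall i, exists G : R, forall z, l2norm (gradient (f i) z) <= G) ->
  argmin_sum f !=set0 ->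
  (forall t : R, 0 <= t -> 0 < alpha t) ->
  (forall s t : R, 0 <= s -> s <= t -> alpha t <= alpha s) ->
  (\int[@lebesgue_measure R]_(t in `[0%R, +oo[) (alpha t)%:E = +oo)%E ->
  (\int[@lebesgue_measure R]_(t in `[0%R, +oo[) (alpha t ^+ 2)%:E < +oo)%E ->
  trajectory (pushsum d L) u x w -> unit_weights (x 0, w 0) ->
  (forall (t : R) (i : 'I_n), 0 <= t -> row i (u t) =
    - alpha t *: gradient (f i) (output (pushsum d L) u x w i t)) ->
  exists2 xstar : 'rV[R]_d, argmin_sum f xstar &
    forall i : 'I_n, output (pushsum d L) u x w i t @[t --> +oo] --> xstar.
Proof.
move=> n0 Llap flow [p p0 Phip] erg fconv fdiff /choice[Gi GiP] [z0 z0min].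
move=> alpha0 alphani alphaoo alpha2 xw w0 uE.
have wp := weights_ge Llap flow Phip xw w0.
have wpos r : 0 <= r -> forall i, 0 <= weights (w r) i 0.
  by move=> r0 j; apply: le_trans (wp r r0 j); exact: ltW.
pose G := \sum_i `|Gi i|.
have G0 : 0 <= G by exact: sumr_ge0.
have fG i z j : `|gradient (f i) z 0 j| <= G.
  rewrite (le_trans (l2norm_entry_le _ j))// (le_trans (GiP i z))//.
  rewrite (le_trans (ler_norm _))// /G (bigD1 i)//= lerDl.
  exact: sumr_ge0.
have [T T0 halves] := ergodic_halves_zero_sum d n0 erg.
pose H := (n * d)%:R * G.
have H0 : 0 <= H by rewrite mulr_ge0.
pose tk k := k%:R * T.
have tk0 k : 0 <= tk k by rewrite mulr_ge0// ltW.
have tkS k : tk k.+1 = tk k + T by rewrite /tk -natr1 mulrDl mul1r.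
have tkS_le k : tk k <= tk k.+1 by rewrite tkS lerDl ltW.
pose a k := alpha (tk k); pose xi k := avg (x (tk k)).
pose e k := l1norm (disagreement (x (tk k)) (w (tk k))).
have a0 k : 0 <= a k by exact/ltW/alpha0.
have e0 k : 0 <= e k by exact: l1norm_ge0.
have maj k r : input_majorant u (tk k) r (fun r => a k * H * r) (fun=> a k * H).
  exact: (feedback_majorant _ G0 fG alpha0 alphani uE (tk0 k)).
pose C := n.+1%:R * (H * T).
have C0 : 0 <= C by rewrite mulr_ge0// mulr_ge0// ltW.
have e_within k t : tk k <= t -> t <= tk k.+1 ->
    l1norm (disagreement (x t) (w t)) <= e k + C * a k.
  move=> kt tkt.
  apply: le_trans (disagreement_le n0 Llap xw w0 wpos (tk0 k) kt (maj k t)) _.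
  rewrite lerD2l -mulrBr /C.
  have -> : n.+1%:R * (H * T) * a k = n.+1%:R * (a k * H * T) by ring.
  by apply: ler_wpM2l => //; apply: ler_wpM2l; rewrite ?mulr_ge0// lerBlDl -tkS.
have estep k : e k.+1 <= 2^-1 * e k + C * a k.
  rewrite {1}/e; apply: le_trans (disagreement_flow_le n0 Llap flow xw w0 wpos
    (tk0 k) (tkS_le k) (maj k _)) _.
  apply: lerD.
    rewrite tkS; apply: halves => // j; exact: disagreement_zero_sum xw w0 (tk0 k).
  rewrite -mulrBr tkS [tk k + T]addrC addrK /C.
  by rewrite le_eqVlt; apply/orP; left; apply/eqP; ring.
have adiv M : exists N, M < \sum_(k < N) a k.+1.
  have [N HN] := integral_infinite_sums T0 alphani (fun t t0 => ltW (alpha0 t t0))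
    alphaoo (M + a 0%N).
  exists N; case: N HN => [|N] HN.
    by move: HN; rewrite !big_ord0; have := a0 0%N; lra.
  have HN2 : \sum_(k < N.+1) alpha (k%:R * T) = a 0%N + \sum_(k < N) a k.+1.
    by rewrite big_ord_recl.
  rewrite big_ord_recr/=; have := a0 N.+1.
  move: HN; rewrite HN2; lra.
have [A aA] : exists A, forall N, \sum_(k < N) a k ^+ 2 <= A.
  apply: (integral_finite_sums (f := fun t => alpha t ^+ 2) T0) => //.
  - move=> s t s0 st; have t0 : 0 <= t by exact: le_trans st.
    by rewrite ler_pXn2r ?nnegrE ?(ltW (alpha0 _ _))// alphani.
  - by move=> t _; exact: sqr_ge0.
have eB := halving_sum_sqr C0 a0 e0 estep aA.
set B := 2 * _ in eB.
(* Coefficients of [a k * e k] and of [a k ^+ 2] in the one-step error. *)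
pose A1 := 4 * G * T * p^-1.
pose A2 := 4 * G * T * (p^-1 * C + H * T) + (H * T) ^+ 2.
have HT0 : 0 <= H * T by rewrite mulr_ge0// ltW.
have A10 : 0 <= A1.
  by apply: mulr_ge0;
    [apply: mulr_ge0; [exact: mulr_ge0|exact: ltW]|rewrite invr_ge0 ltW].
have A20 : 0 <= A2.
  apply: addr_ge0; last exact: sqr_ge0.
  apply: mulr_ge0; first by apply: mulr_ge0; [exact: mulr_ge0|exact: ltW].
  by apply: addr_ge0 => //; apply: mulr_ge0 => //; rewrite invr_ge0 ltW.
pose b k := A1 * (a k * e k) + A2 * a k ^+ 2.
have b0 k : 0 <= b k.
  by apply: addr_ge0; apply: mulr_ge0 => //; [exact: mulr_ge0|exact: sqr_ge0].
have bB N : \sum_(k < N) b k <= A1 * (A + B) + A2 * A.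
  apply: (@le_trans _ _ (\sum_(k < N) (A1 * (a k ^+ 2 + e k ^+ 2) + A2 * a k ^+ 2))).
    apply: ler_sum => k _; rewrite lerD2r ler_wpM2l//.
    have : 0 <= (a k - e k) ^+ 2 by exact: sqr_ge0.
    have := mulr_ge0 (a0 k) (e0 k); rewrite sqrrB; lra.
  rewrite big_split/= -!mulr_sumr big_split/=.
  apply: lerD; apply: ler_wpM2l => //; last exact: aA.
  by apply: lerD; [exact: aA|exact: eB].
have descent k z t : argmin_sum f z -> tk k <= t -> t <= tk k.+1 ->
    sqdist (avg (x t)) z <= sqdist (xi k) z
    - 2 * (t - tk k) * (n%:R^-1 * alpha t * (\sum_i f i (xi k) - \sum_i f i z)) + b k.
  move=> zmin kt tk1; rewrite tkS in tk1.
  apply: le_trans (sqdist_descent n0 Llap xw w0 p0 wp fconv fdiff G0 fG (erefl H)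
    alpha0 alphani uE zmin (tk0 k) kt tk1) _.
  rewrite lerD2l /b /A1 /A2 /C -/(a k) -/(e k).
  by rewrite le_eqVlt; apply/orP; left; apply/eqP; ring.
have [|||||||||z zmin zcv] := @quasi_fejer_converges R d (fun z => \sum_i f i z) xi
  (fun k => a k.+1) b (2 * T * n%:R^-1) (A1 * (A + B) + A2 * A) (n%:R * G).
- by rewrite mulr_gt0 ?invr_gt0 ?ltr0n// mulr_gt0.
- exact: mulr_ge0.
- move=> z z'; rewrite -sumrB.
  apply: (@le_trans _ _ (\sum_(i < n) G * l1norm (z - z'))).
    apply: ler_sum => i _; exact: convex_lipschitz (fconv i) (fdiff i z) (fG i z).
  by rewrite sumr_const card_ord -mulrA mulr_natl.
- by exists z0.
- by move=> k; exact: a0.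
- exact: b0.
- exact: adiv.
- exact: bB.
- move=> z zmin k; apply: le_trans (descent k z _ zmin (tkS_le k) (lexx _)) _.
  rewrite tkS [tk k + T]addrC addrK -[in alpha _]addrC -tkS -/(a k.+1).
  by rewrite le_eqVlt; apply/orP; left; apply/eqP; ring.
exists z => // i; apply/cvgrPdist_le => eps eps0.
pose eps1 := eps / 2.
have eps10 : 0 < eps1 by rewrite divr_gt0.
pose D := p^-1 * (1 + C).
have D0 : 0 < D by rewrite mulr_gt0 ?invr_gt0// ltr_pwDl.
(* [e k] and [a k] below [del] make the tracking errors at most [eps1]. *)
pose del := eps1 / D.
have del0 : 0 < del by rewrite divr_gt0.
have [N1 HN1] : exists N, forall k, (N <= k)%N -> e k <= del /\ a k <= del.
  have sqs k : 0 <= a k ^+ 2 + e k ^+ 2 by rewrite addr_ge0// sqr_ge0.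
  have sqB N : \sum_(k < N) (a k ^+ 2 + e k ^+ 2) <= A + B.
    by rewrite big_split/=; apply: lerD; [exact: aA|exact: eB].
  have [|N HN] := bounded_sums_tail (delta := del ^+ 2) sqs sqB.
    by rewrite exprn_gt0.
  exists N => k Nk; have := HN k 1%N Nk; rewrite addn1 big_nat1 => Hk.
  have := sqr_ge0 (a k); have := sqr_ge0 (e k).
  by move=> ? ?; split; apply: le_of_sqr_le (ltW del0) _; lra.
have [N2 HN2] := zcv (eps1 ^+ 2 / 2) (divr_gt0 (exprn_gt0 2 eps10) (ltr0n _ 2)).
have [|N3 HN3] := bounded_sums_tail (delta := eps1 ^+ 2 / 2) b0 bB.
  by rewrite divr_gt0// exprn_gt0.
pose N := maxn N1 (maxn N2 N3).
exists (tk N); split; first exact: num_real.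
move=> t Nt.
have t0 : 0 <= t by rewrite (le_trans (tk0 N))// ltW.
pose k := Num.truncn (t / T).
have [kt tk1] : tk k <= t /\ t <= tk k.+1.
  have /Num.Theory.truncn_itv : 0 <= t / T by rewrite divr_ge0// ltW.
  by rewrite ler_pdivlMr// ltr_pdivrMr// => /andP[? /ltW].
have Nk : (N <= k)%N.
  by rewrite -ltnS -(@ltr_nat R) -(ltr_pM2r T0); exact: lt_le_trans tk1.
have [N1k N2k N3k] : [/\ (N1 <= k)%N, (N2 <= k)%N & (N3 <= k)%N].
  by move: Nk; rewrite !geq_max => /and3P[].
have [ek ak] := HN1 k N1k.
have Hout : l1norm (output (pushsum d L) u x w i t - avg (x t)) <= eps1.
  apply: (le_trans (output_error_le L u x p0 (wp t t0 i))).
  have -> : eps1 = p^-1 * ((1 + C) * del).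
    by rewrite mulrA -/D mulrC mulfVK// gt_eqF.
  rewrite ler_pM2l ?invr_gt0// (le_trans (e_within k t kt tk1))//.
  by rewrite mulrDl mul1r lerD// ler_wpM2l.
have Havg : `|z - avg (x t)| <= eps1.
  apply: mx_normr_le; first exact: ltW.
  move=> i' j; rewrite ord1 -normrN; apply: le_of_sqr_le; first exact: ltW.
  rewrite real_normK ?num_real//.
  apply: (@le_trans _ _ (sqdist (avg (x t)) z)).
    rewrite /sqdist (bigD1 j)//= [X in X <= _](_ : _ = (avg (x t) - z) 0 j ^+ 2).
      by rewrite lerDl sumr_ge0// => l _; rewrite sqr_ge0.
    by rewrite !mxE opprB.
  apply: (le_trans (descent k z t zmin kt tk1)).
  have := HN2 k N2k; have := HN3 k 1%N N3k; rewrite addn1 big_nat1.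
  have : 0 <= 2 * (t - tk k) *
      (n%:R^-1 * alpha t * (\sum_i f i (xi k) - \sum_i f i z)).
    apply: mulr_ge0; first by rewrite mulr_ge0// subr_ge0.
    apply: mulr_ge0; first by rewrite mulr_ge0 ?invr_ge0// ltW// alpha0.
    by rewrite subr_ge0; exact: zmin.
  lra.
rewrite -(subrKA (avg (x t))) (le_trans (ler_normD _ _))//.
have : `|avg (x t) - output (pushsum d L) u x w i t| <= eps1.
  rewrite distrC; apply: mx_normr_le; first exact: ltW.
  by move=> i' j; apply: le_trans Hout; exact: l1norm_entry_le.
move: Havg; rewrite /eps1; lra.
Qed.

Theorem theorem5p2 (R : realType) (n d : nat) (n_gt0 : (0 < n)%N)
    (d_gt0 : (0 < d)%N) (L : R -> 'M[R]_n) (Phi : R -> R -> 'M[R]_n)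
    (L_laplacian : forall t : R, 0 <= t -> generalized_laplacian (L t))
    (L_measurable : measurable_family L)
    (L_bounded : locally_ess_bounded L)
    (Phi_flow : is_flow L Phi)
    (Phi_Pstar : class_Pstar Phi)
    (Phi_ergodic : weakly_exp_ergodic Phi) :
  distributed_flow_tracker (pushsum d L) (laplacian_graph L)
    (@unit_weights R n d) /\
  (forall (f : 'I_n -> 'rV[R]_d -> R) (alpha : R -> R),
    (forall i, convex_function setT (f i)) ->
    (forall i z, differentiable (f i) z) ->
    (forall i, exists G : R, forall z, l2norm (gradient (f i) z) <= G) ->
    argmin_sum f !=set0 ->
    (forall t : R, 0 <= t -> 0 < alpha t <= 1) ->
    (forall s t : R, 0 <= s -> s <= t -> alpha t <= alpha s) ->
    (\int[@lebesgue_measure R]_(t in `[0%R, +oo[) (alpha t)%:E = +oo)%E ->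
    (\int[@lebesgue_measure R]_(t in `[0%R, +oo[) (alpha t ^+ 2)%:E < +oo)%E ->
    forall (u x : R -> 'M[R]_(n, d)) (w : R -> wstate R (fun _ : 'I_n => 1%N)),
      trajectory (pushsum d L) u x w ->
      unit_weights (x 0, w 0) ->
      (forall (t : R) (i : 'I_n), 0 <= t ->
        row i (u t) =
        - alpha t *: gradient (f i) (output (pushsum d L) u x w i t)) ->
      exists2 xstar : 'rV[R]_d, argmin_sum f xstar &
        forall i : 'I_n,
          output (pushsum d L) u x w i t @[t --> +oo] --> xstar).
Proof.
split.
  split.
  - exact: pushsum_local.
  - exact: pushsum_average.
  - exact: pushsum_tracks Phi_flow Phi_Pstar Phi_ergodic.
move=> f alpha fconv fdiff fG fmin alpha01 alphani alphaoo alpha2 u x w xw w0 uE.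
have alpha0 t : 0 <= t -> 0 < alpha t by move=> /alpha01 /andP[].
exact: (pushsum_descent_converges n_gt0 L_laplacian Phi_flow Phi_Pstar
  Phi_ergodic fconv fdiff fG fmin alpha0 alphani alphaoo alpha2 xw w0 uE).
Qed.
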